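(* Let $\theta=\log\mu$, $\eta=\log a$ with $a=1-\rho$, $\bar\lambda=\mu/(1-\rho)$, $V=\lambda/\bar\lambda$, $\mathcal I_T=T\mu(1-\rho)$ and $$A_T=\frac1T\,\mathbb E\int_0^T\frac{\mathrm dt}{V(t)},\qquad D_T=\frac1T\,\mathbb E\int_0^TV(t)\,\mathrm dt.$$ For the linear Hawkes process with baseline $\mu>0$, branching ratio $\rho\in(0,1)$ and known kernel shape $g$, started empty, the Fisher information matrix of $(\theta,\eta)$ on $[0,T]$ is $$\mathcal J_T=\mathcal I_T\begin{pmatrix}A_T&-\dfrac{1-aA_T}{\rho}\\[2mm]-\dfrac{1-aA_T}{\rho}&\dfrac{D_T-2a+a^2A_T}{\rho^2}\end{pmatrix}.$$ Consequently, the efficient informations are $$\mathcal J^{\rm eff}_{\log\mu,T}=\mathcal I_T\,\frac{A_TD_T-1}{D_T-2a+a^2A_T},\qquad \mathcal J^{\rm eff}_{\log(1-\rho),T}=\frac{\mathcal I_T}{\rho^2}\Big(D_T-\frac1{A_T}\Big)\le\frac{\mathcal I_T}{\rho^2}.$$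
   Context: $N$ is the linear Hawkes process started empty at time $s_0\le0$ (no points at or before $s_0$) and observed on $[0,T]$: a simple point process on $(s_0,\infty)$ with stochastic intensity $\lambda(t)=\mu+\rho\int_{(s_0,t)}g(t-s)\,N(\mathrm ds)$, where $g\ge0$ and $\int_0^\infty g=1$. The log-likelihood on $[0,T]$ (conditional on the pre-sample points in $(s_0,0]$, a vacuous conditioning if $s_0=0$) is $\int_{(0,T]}\log\lambda(t)\,N(\mathrm dt)-\int_0^T\lambda(t)\,\mathrm dt$, viewed as a function of $(\theta,\eta)$ through $\mu=e^\theta$, $\rho=1-e^\eta$. The Fisher information matrix is the covariance matrix of the gradient (score) of this log-likelihood at the true parameter, i.e. $\mathbb E\int_0^T(\nabla\lambda)(\nabla\lambda)^\top\lambda^{-1}\,\mathrm dt$. The efficient information of one of the two parameters is the corresponding Schur complement: $\mathcal J^{\rm eff}_{\log\mu,T}=\mathcal J_{\theta\theta}-\mathcal J_{\theta\eta}^2/\mathcal J_{\eta\eta}$ and $\mathcal J^{\rm eff}_{\log(1-\rho),T}=\mathcal J_{\eta\eta}-\mathcal J_{\theta\eta}^2/\mathcal J_{\theta\theta}$ (defined when the denominator is nonzero). *)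

(* Defs.v *)
From HB Require Import structures.
From mathcomp Require Import all_boot all_order all_algebra.
From mathcomp Require Import all_classical all_reals all_analysis.
From mathcomp Require Import measurable_realfun.

Set Implicit Arguments.
Unset Strict Implicit.
Unset Printing Implicit Defensive.
Import Order.TTheory GRing.Theory Num.Theory.
Import numFieldNormedType.Exports.

Local Open Scope classical_set_scope.
Local Open Scope ring_scope.

Section PointProcess.
Context (d : measure_display) (Omega : measurableType d) (R : realType).
Implicit Types (P : probability Omega R)
  (N : R.-ker Omega ~> (measurableTypeR R)) (t : R).

(* N is a random measure on the line; every realization is the counting
   measure of a set X of points of (s0, oo) that is finite on bounded sets.
   Points have multiplicity one because X is a set. *)
Definition simple_point_process N (s0 : R) : Prop :=
  forall w, exists X : set R,
    [/\ X `<=` `]s0, +oo[,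
        forall b : R, finite_set (X `&` `]-oo, b]) &
        forall B : set (measurableTypeR R), measurable B ->
          N w B = counting (X `&` B)].

(* Internal history F_t = sigma(N(B) : B Borel, B included in (-oo, t]). *)
Definition history N t : set (set Omega) :=
  <<s [set A : set Omega | exists (B : set (measurableTypeR R)) (U : set (\bar R)),
         [/\ measurable B, B `<=` `]-oo, t], measurable U &
             A = (fun w => N w B) @^-1` U]] >>.

Definition predictable_rectangles N : set (set (R * Omega)) :=
  [set C | exists (a b : R) (A : set Omega),
      history N a A /\ C = `]a, b] `*` A].

Definition predictable N (C : R * Omega -> \bar R) : Prop :=
  measurable_fun setT
    (C : g_sigma_algebraType (predictable_rectangles N) -> \bar R).

(* Stochastic intensity with respect to the internal history, in Bremaud's
   sense: E int C dN = E int C lambda dt for all predictable C >= 0. *)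
Definition stochastic_intensity P N (s0 : R) (lambda : R -> Omega -> R) : Prop :=
  [/\ forall t w, 0 <= lambda t w,
      predictable N (fun x => (lambda x.1 x.2)%:E),
      forall b : R, {ae P, forall w,
        (\int[lebesgue_measure]_(t in `]s0, b]) (lambda t w)%:E < +oo)%E} &
      forall C : R * Omega -> \bar R,
        predictable N C -> (forall x, (0 <= C x)%E) ->
        (\int[P]_w \int[N w]_(t in `]s0, +oo[) C (t, w) =
         \int[P]_w \int[lebesgue_measure]_(t in `]s0, +oo[)
           (C (t, w) * (lambda t w)%:E))%E].

End PointProcess.

Section Hawkes.
Context (d : measure_display) (Omega : measurableType d) (R : realType).
Implicit Types (P : probability Omega R)
  (N : R.-ker Omega ~> (measurableTypeR R))
  (g : R -> R) (T mu rho theta eta : R).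

(* Only the values of g on [0, oo) matter. *)
Definition kernel_shape g : Prop :=
  [/\ measurable_fun (`[0, +oo[ : set (measurableTypeR R)) g,
      forall u, 0 <= u -> 0 <= g u &
      (\int[lebesgue_measure]_(u in `[0%R, +oo[) (g u)%:E = 1)%E].

Definition hawkes_lambda N g (s0 : R) mu rho (t : R) (w : Omega) : R :=
  mu + rho * \int[N w]_(s in `]s0, t[) g (t - s).

Definition linear_hawkes P N g (s0 : R) mu rho : Prop :=
  simple_point_process N s0 /\
  stochastic_intensity P N s0 (hawkes_lambda N g s0 mu rho).

Definition loglik N g (s0 : R) T theta eta (w : Omega) : R :=
  let lambda := hawkes_lambda N g s0 (expR theta) (1 - expR eta) in
  \int[N w]_(t in `]0, T]) ln (lambda t w)
  - \int[lebesgue_measure]_(t in `[0, T]) lambda t w.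

(* Components of the gradient of the log-likelihood at (theta, eta):
   index 0 is the theta-derivative, index 1 the eta-derivative. *)
Definition score N g (s0 : R) T theta eta (i : 'I_2) (w : Omega) : R :=
  if i == 0 then derive1 (fun x => loglik N g s0 T x eta w) theta
  else derive1 (fun y => loglik N g s0 T theta y w) eta.

Definition fisher_info P N g (s0 : R) T theta eta : 'M[R]_2 :=
  \matrix_(i < 2, j < 2)
    fine (covariance P (score N g s0 T theta eta i)
                       (score N g s0 T theta eta j)).

Definition mx2 (a b c e : R) : 'M[R]_2 :=
  \matrix_(i < 2, j < 2)
    if i == 0 then (if j == 0 then a else b) else (if j == 0 then c else e).

Definition efficient_info0 (J : 'M[R]_2) : R := J 0 0 - J 0 1 ^+ 2 / J 1 1.

Definition efficient_info1 (J : 'M[R]_2) : R := J 1 1 - J 0 1 ^+ 2 / J 0 0.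

(* V = lambda / (mu / (1 - rho)) *)
Definition rel_intensity N g (s0 : R) mu rho (t : R) (w : Omega) : R :=
  hawkes_lambda N g s0 mu rho t w / (mu / (1 - rho)).

Definition int_invV N g (s0 : R) T mu rho (w : Omega) : R :=
  \int[lebesgue_measure]_(t in `[0, T]) (rel_intensity N g s0 mu rho t w)^-1.

Definition int_V N g (s0 : R) T mu rho (w : Omega) : R :=
  \int[lebesgue_measure]_(t in `[0, T]) rel_intensity N g s0 mu rho t w.

Definition A_coef P N g (s0 : R) T mu rho : R :=
  T^-1 * fine 'E_P[int_invV N g s0 T mu rho].

Definition D_coef P N g (s0 : R) T mu rho : R :=
  T^-1 * fine 'E_P[int_V N g s0 T mu rho].

(* What is needed for the totalized operators above to have their usual
   meaning: the score exists and has finite second moments, and the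
   expectations defining A_T and D_T are finite. *)
Definition fisher_well_defined P N g (s0 : R) T mu rho : Prop :=
  let theta := ln mu in
  let eta := ln (1 - rho) in
  [/\ forall w, derivable (fun x : R => loglik N g s0 T x eta w) theta 1,
      forall w, derivable (fun y : R => loglik N g s0 T theta y w) eta 1,
      forall i, score N g s0 T theta eta i \in Lfun P 2%:E,
      int_invV N g s0 T mu rho \in Lfun P 1 &
      int_V N g s0 T mu rho \in Lfun P 1].

End Hawkes.

(* Main.v *)
Require Import Defs.
From HB Require Import structures.
From mathcomp Require Import all_boot all_order all_algebra.
From mathcomp Require finmap.
From mathcomp Require Import all_classical all_reals all_analysis.
From mathcomp Require Import measurable_realfun ring lra.
Import Order.TTheory GRing.Theory Num.Theory.
Import numFieldNormedType.Exports.
Local Open Scope classical_set_scope.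
Local Open Scope ring_scope.

(** Write lambda for the intensity and a = 1 - rho.  On the window (0, T] put

      h1 = mu / lambda,   h2 = 1 - mu / lambda,   h0 = h1 + h2 = 1,

    and for such a predictable integrand h let X h be the compensated integral
    of h, that is the integral of h against N minus the integral of h lambda.
    Differentiating the log-likelihood path by path (it is a finite sum over
    the points in the window, minus an affine function of mu and rho) shows
    that the score is (X h1, - (a / rho) X h2): multiplying mu by a factor only
    touches the baseline part mu of lambda, and changing log (1 - rho) only
    touches lambda - mu = rho times the excitation, with derivative
    - (a / rho) (lambda - mu).

    The covariances of the X h come from the isometry
    Var (X h) = E int h^2 lambda dt =: v h, lemma [variance_compensated].  It is
    obtained without martingale theory: the squares and the product of the
    integrals against N and against lambda dt are double integrals, which
    Tonelli's theorem splits along the diagonal into single integrals of an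
    integral over the strict past ([integral_product_split]).  Integrals over
    the strict past are predictable ([predictable_integral_past]), so the
    defining property of the intensity replaces every N(dt) by lambda dt under
    the expectation, and only the diagonal of N x N, which contributes
    E int h^2 lambda, does not cancel ([expectation_square_identity]).

    With d = D_T and A = A_T, the definitions give v h1 = T mu a A and
    v h0 = T mu d / a.  The pointwise identity
    lambda + mu^2 / lambda = (lambda - mu)^2 / lambda + 2 mu integrates to
    v h0 + v h1 = v h2 + 2 mu T, and X h0 = X h1 + X h2 then forces
    Cov (X h1, X h2) = mu T - v h1.  With a factor - (a / rho) for each index
    eta, the numbers v h1, Cov (X h1, X h2) and v h2 are the entries of the
    Fisher matrix.  Moreover v h1 cannot vanish, since by Cauchy-Schwarz the
    covariance would vanish too whereas it would equal mu T; hence A > 0.  The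
    efficient informations are Schur complements, and the bound on the second
    one amounts to D_T <= 1 and A > 0.

    Two estimates on the process are needed.  Square integrability of the
    counts ([expected_square_count_lty]) legitimates the isometry: up to time
    T the compensator B of the count U satisfies B <= c + rho U with
    c = mu (T - s0), so that (1 - rho) U <= c + (U - B), and the isometry itself
    bounds the second moment of U - B by E U.  To run this argument on finite quantities the
    process is first stopped when it has accumulated n points, which keeps the
    integrand predictable and the inequality B <= c + rho U true.  The
    bound D_T <= 1 ([expected_integral_le]) says that the process started
    empty stays below its stationary rate: for a test function phi,
    E int phi dN <= mu int phi + rho E int phi' dN, where phi' is obtained by
    averaging phi over the future with weights g, has the same integral as phi
    and is still bounded by 1 and supported before T, so the supremum S of the
    left-hand sides over such phi of integral at most L satisfies
    S <= mu L + rho S, that is S <= mu L / (1 - rho). *)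

(** * Integrals and derivatives *)

Lemma ge0_integral_mrestr {d} {T : measurableType d} {R : realType}
    (mu : {measure set T -> \bar R}) (D : set T) (mD : measurable D)
    (f : T -> \bar R) :
  measurable_fun setT f -> (forall x, (0 <= f x)%E) ->
  (\int[mrestr mu mD]_x f x = \int[mu]_(x in D) f x)%E.
Proof.
move=> mf f0; rewrite [LHS](@ge0_negligible_integral _ _ _ _ setT (~` D))//.
- rewrite setTD setCK; apply: eq_measure_integral => A mA AD.
  by rewrite /= /mrestr setIidl.
- exact: measurableC.
- by rewrite /= /mrestr setICl measure0.
Qed.

Lemma ge0_integralDT {d} {T : measurableType d} {R : realType}
    {mu : {measure set T -> \bar R}} {f g : T -> \bar R} :
  measurable_fun setT f -> (forall x, (0 <= f x)%E) ->
  measurable_fun setT g -> (forall x, (0 <= g x)%E) ->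
  (\int[mu]_x (f x + g x) = \int[mu]_x f x + \int[mu]_x g x)%E.
Proof. by move=> mf f0 mg g0; rewrite ge0_integralD. Qed.

Lemma is_derive_affine_expR {R : realType} (c k x : R) :
  is_derive x (1 : R) (fun y => c + k * expR y) (k * expR x).
Proof.
have := is_deriveD (is_derive_cst c x (1 : R)) (is_deriveZ k (is_derive_expR x)).
by rewrite add0r.
Qed.

Lemma is_derive_ln_affine_expR {R : realType} (c k x : R) : 0 < c + k * expR x ->
  is_derive x (1 : R) (fun y => ln (c + k * expR y)) (k * expR x / (c + k * expR x)).
Proof.
move=> pos; rewrite mulrC.
exact: (@is_derive1_comp R (@ln R) (fun y => c + k * expR y) x _ _
  (is_derive1_ln pos) (is_derive_affine_expR c k x)).
Qed.

Lemma is_derive_bigsum {R : realType} {I : Type} (s : seq I) (f : I -> R -> R) (df : I -> R)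
    (x : R) : (forall i, is_derive x (1 : R) (f i) (df i)) ->
  is_derive x (1 : R) (fun y => \sum_(i <- s) f i y) (\sum_(i <- s) df i).
Proof.
move=> fP; elim: s => [|i l IHl].
  by rewrite big_nil; under eq_fun do rewrite big_nil; exact: is_derive_cst.
by rewrite big_cons; under eq_fun do rewrite big_cons; exact: is_deriveD.
Qed.

Lemma integral_indicT {d} {T : measurableType d} {R : realType}
    (mu : {measure set T -> \bar R}) {A : set T} : measurable A ->
  (\int[mu]_x (\1_A x)%:E = mu A)%E.
Proof. by move=> mA; rewrite integral_indic// setIT. Qed.

Lemma Lfun2P {d} {T : measurableType d} {R : realType} (mu : {measure set T -> \bar R})
    (f : T -> R) : measurable_fun setT f ->
  (\int[mu]_x (f x ^+ 2)%:E < +oo)%E -> f \in Lfun mu 2%:E.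
Proof.
move=> mf f2; rewrite inE; apply/andP; split; rewrite inE//=.
rewrite /finite_norm unlock /Lnorm poweR_lty//.
rewrite (eq_integral (fun x => (f x ^+ 2)%:E))// => x _.
by rewrite /= -poweR_EFin; congr EFin; rewrite (powR_mulrn 2)// real_normK ?num_real.
Qed.

(** * Predictability of integrals over the past *)

Section Predictability.
Context {d : measure_display} {Omega : measurableType d} {R : realType}.
Variable N : R.-ker Omega ~> (measurableTypeR R).
Local Notation predSp := (g_sigma_algebraType (predictable_rectangles N)).
Local Notation time := (measurableTypeR R).
Implicit Types (A : set Omega) (B : set time) (t : time) (w : Omega).

Lemma sub_history t t' A : t <= t' -> history N t A -> history N t' A.
Proof.
move=> tt'; apply: sub_sigma_algebra2 => _ [B [U [mB Bt mU ->]]].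
exists B, U; split => //; apply: subset_trans Bt _ => s /=.
by rewrite !in_itv/= => /le_trans; apply.
Qed.

Lemma history_measurable t A : history N t A -> measurable A.
Proof.
move=> tA; apply: (smallest_sub (@sigma_algebra_measurable _ Omega) _ tA).
move=> _ [B [U [mB _ mU ->]]]; rewrite -(setTI (_ @^-1` _)).
exact: measurable_kernel.
Qed.

Lemma sigma_algebra_history t : sigma_algebra setT (history N t).
Proof. exact: smallest_sigma_algebra. Qed.

Lemma history0 t : history N t set0.
Proof. by have [] := sigma_algebra_history t. Qed.

Lemma historyC t A : history N t A -> history N t (~` A).
Proof. by rewrite -setTD; have [_ + _] := sigma_algebra_history t; apply. Qed.

Lemma historyT t : history N t setT.
Proof. by rewrite -setC0; apply: historyC; exact: history0. Qed.

Lemma historyU t A A' :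
  history N t A -> history N t A' -> history N t (A `|` A').
Proof.
move=> tA tA'; rewrite -bigcup2E.
have [_ _] := sigma_algebra_history t; apply => -[|[|n]]//=.
exact: history0.
Qed.

Lemma historyI t A A' :
  history N t A -> history N t A' -> history N t (A `&` A').
Proof.
move=> tA tA'; rewrite -(setCK (_ `&` _)) setCI.
by apply: historyC; apply: historyU; exact: historyC.
Qed.

Definition adapted_at t (Y : Omega -> \bar R) :=
  forall U, measurable U -> history N t (Y @^-1` U).

Lemma adapted_at_cst t (c : \bar R) : adapted_at t (cst c).
Proof.
move=> U _; rewrite preimage_cst; case: ifPn => _; [exact: historyT|exact: history0].
Qed.

Lemma adapted_at_restrict {t} {Y : Omega -> \bar R} {A} : adapted_at t Y -> history N t A ->
  adapted_at t (Y \_ A).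
Proof.
move=> tY tA U mU.
have -> : (Y \_ A) @^-1` U =
    (A `&` Y @^-1` U) `|` (~` A `&` (cst 0%E : _ -> \bar R) @^-1` U).
  apply/seteqP; split=> [w|w]; rewrite /preimage/= patchE.
    by case: ifPn => [/set_mem ? ?|/negP Aw ?]; [left|right; split=> //= /mem_set].
  by case=> -[Aw Uw]; case: ifPn => //; [rewrite notin_setE|move/set_mem].
apply: historyU; apply: historyI => //; [exact: tY|exact: historyC|].
exact: adapted_at_cst.
Qed.

Lemma measurable_rectangle {a b : R} {A} : history N a A ->
  measurable (`]a, b] `*` A : set predSp).
Proof. by move=> aA; apply: sub_sigma_algebra; exists a, b, A. Qed.

Lemma measurable_right_rectangle {a : R} {A} : history N a A ->
  measurable (`]a, +oo[ `*` A : set predSp).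
Proof.
move=> aA.
have -> : `]a, +oo[ `*` A = \bigcup_n (`]a, a + n%:R] `*` A).
  apply/seteqP; split=> [[t w] [/= + Aw]|[t w] [n _ /= [+ Aw]]]; rewrite !in_itv/=.
    rewrite andbT => at_; exists (Num.truncn (t - a)).+1 => //=; split=> //.
    by rewrite in_itv/= at_/= -lerBlDl ltW// Num.Theory.truncnS_gt.
  by move=> /andP[-> _].
by apply: bigcup_measurable => n _; exact: measurable_rectangle.
Qed.

Lemma measurable_pair_time w : measurable_fun setT (fun t : time => (t, w) : predSp).
Proof.
apply: (@measurability _ _ time predSp _ _ (predictable_rectangles N)) => //.
move=> _ [_ [a [b [A [_ ->]]]] <-].
rewrite setTI; have [Aw|Aw] := pselect (A w).
  rewrite (_ : _ @^-1` _ = `]a, b]%classic); first exact: measurable_itv.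
  by apply/seteqP; split=> [t []|t].
by rewrite (_ : _ @^-1` _ = set0)//; apply/seteqP; split=> [t []|t].
Qed.

Lemma measurable_pair_outcome t : measurable_fun setT (fun w => (t, w) : predSp).
Proof.
apply: (@measurability _ _ Omega predSp _ _ (predictable_rectangles N)) => //.
move=> _ [_ [a [b [A [aA ->]]]] <-].
rewrite setTI; have [Aw|Aw] := pselect (`]a, b]%classic t).
  rewrite (_ : _ @^-1` _ = A); first exact: history_measurable aA.
  by apply/seteqP; split=> [w []|w].
by rewrite (_ : _ @^-1` _ = set0)//; apply/seteqP; split=> [w []|w].
Qed.

Lemma measurable_time : measurable_fun setT (fst : predSp -> time).
Proof.
apply: (@measurability _ _ predSp time _ _ (@ocitv R)) => // _ [_ [[a b] _ <-] <-].
rewrite setTI (_ : _ @^-1` _ = `]a, b] `*` setT).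
  exact: measurable_rectangle (historyT _).
by apply/seteqP; split=> [[t w]|[t w] []].
Qed.

Lemma predictable_time (f : time -> \bar R) : measurable_fun setT f ->
  predictable N (fun x => f x.1).
Proof. by move=> mf; exact: measurableT_comp mf measurable_time. Qed.

Lemma predictable_after {q : R} {Y : Omega -> \bar R} : adapted_at q Y ->
  predictable N ((fun x => Y x.2) \_ (`]q, +oo[ `*` setT)).
Proof.
move=> qY; apply/(measurable_restrictT (fun x : predSp => Y x.2)).
  exact: measurable_right_rectangle (historyT _).
move=> _ U mU; rewrite (_ : _ `&` _ = `]q, +oo[ `*` (Y @^-1` U)).
  by apply: measurable_right_rectangle; exact: qY.
by apply/seteqP; split=> [[t w] [[]]|[t w] []].
Qed.

Section AdaptedMeasure.
Local Open Scope ereal_scope.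
Variable nu : Omega -> {measure set time -> \bar R}.
Hypothesis adapted_nu : forall t B, measurable B -> B `<=` `]-oo, t] ->
  adapted_at t (fun w => nu w B).
Hypothesis nu_lty : forall w (b : R), nu w `]-oo, b[%classic < +oo.

(** The process t |-> nu (B :&: (-oo, t)) 1_A is left-continuous and
    nondecreasing: it is the supremum over rational q of the processes that
    vanish up to q and keep from then on the value nu (B :&: (-oo, q]) 1_A known
    at time q.  Such processes are predictable and there are countably many. *)
Lemma predictable_left_limit B A : measurable B ->
  (forall q, adapted_at q ((fun w => nu w (B `&` `]-oo, q])) \_ A)) ->
  predictable N (fun x => ((fun w => nu w (B `&` `]-oo, x.1[)) \_ A) x.2).
Proof.
move=> mB AB.
pose q n : R := ratr (odflt 0%R (unpickle n : option rat)).
pose F n : predSp -> \bar R :=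
  (fun x => ((fun w => nu w (B `&` `]-oo, q n])) \_ A) x.2) \_ (`]q n, +oo[ `*` setT).
have mF n : measurable_fun setT (F n) by exact: predictable_after.
have : measurable_fun setT (fun x => esups (F ^~ x) 0%N).
  exact: measurable_fun_esups.
apply: eq_measurable_fun => -[t w] _.
have mBt (i : interval R) : measurable (B `&` [set` i]).
  by apply: measurableI => //; exact: measurable_itv.
rewrite /esups/= (_ : sdrop _ 0%N = range (F ^~ (t, w))); last first.
  by apply/seteqP; split=> y /= [n]; exists n.
apply/eqP; rewrite eq_le; apply/andP; split.
  apply: ub_ereal_sup => _ [n _ <-]; rewrite /F patchE/=.
  rewrite !patchE; case: ifPn => [/set_mem[/=]|_]; case: ifPn => //= _; last first.
    exact: measure_ge0.
    rewrite in_itv/= andbT => qt _; apply: le_measure; rewrite ?inE//.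
    apply: setIS => s /=; rewrite !in_itv/= => /le_lt_trans; exact.
rewrite patchE; case: ifPn => [Aw|Aw]; last first.
  apply: ereal_sup_ubound; exists 0%N => //.
  by rewrite /F !patchE/= (negbTE Aw); case: ifPn.
pose E n : set time := B `&` `]-oo, (t - n.+1%:R^-1)%R].
have Et : \bigcup_n E n = B `&` `]-oo, t[.
  rewrite -setI_bigcupr; congr (_ `&` _); apply/seteqP; split=> s /=.
    case=> n _ /=; rewrite !in_itv/= => /le_lt_trans; apply.
    by rewrite ltrBlDr ltrDl invr_gt0.
  rewrite in_itv/= => st; exists (Num.truncn (t - s)^-1)%R => //=.
  rewrite in_itv/= lerBrDl addrC -lerBrDl -[leRHS]invrK lef_pV2 ?posrE ?invr_gt0 ?subr_gt0//.
  by rewrite ltW// Num.Theory.truncnS_gt.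
have : nu w \o E @ \oo --> nu w (\bigcup_n E n).
  apply: nondecreasing_cvg_mu => //; first by move=> n; exact: mBt.
    by rewrite Et; exact: mBt.
  move=> m n mn; apply/subsetPset; apply: setIS => s /=; rewrite !in_itv/= => /le_trans; apply.
  by rewrite lerB// lef_pV2 ?posrE// ler_nat.
rewrite Et => cvgE; apply: (cvge_le _ cvgE) => //.
apply: nearW => n /=.
have [r /andP[tr rt]] : exists r : rat, (t - n.+1%:R^-1 < ratr r < t)%R.
  have [] := @rat_in_itvoo R (t - n.+1%:R^-1)%R t.
    by rewrite ltrBlDr ltrDl invr_gt0.
  by move=> r; rewrite in_itv/= => ?; exists r.
apply: le_trans (ereal_sup_ubound _); last by exists (pickle r).
have qr : q (pickle r) = ratr r by rewrite /q pickleK.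
rewrite /F patchE/= qr mem_set; last by split=> //=; rewrite in_itv/= rt.
rewrite patchE Aw; apply: le_measure; rewrite ?inE//; first exact: mBt.
by apply: setIS => s /=; rewrite !in_itv/= => /le_trans; apply; exact: ltW.
Qed.

(** For C a generating rectangle (a, b] x A the event A belongs to the history
    at a, hence is known before the process starts to grow, and the previous
    lemma applies; Dynkin's theorem does the rest.  Complements are taken inside
    (-oo, t), whose measure is finite. *)
Lemma predictable_measure_past (C : set predSp) : measurable C ->
  predictable N (fun x => nu x.2 ([set s | C (s, x.2)] `&` `]-oo, x.1[)).
Proof.
have mC (C' : set predSp) w : measurable C' -> measurable [set s : time | C' (s, w)].
  by move=> mC'; rewrite -(setTI [set _ | _]); exact: measurable_pair_time.
have mitv (t : R) : measurable (`]-oo, t[ : set time) by exact: measurable_itv.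
have mCt (C' : set predSp) w t : measurable C' ->
    measurable ([set s : time | C' (s, w)] `&` `]-oo, t[).
  by move=> mC'; apply: measurableI => //; exact: mC.
have nufin (C' : set predSp) w (t : R) : measurable C' ->
    nu w ([set s | C' (s, w)] `&` `]-oo, t[) \is a fin_num.
  move=> mC'; rewrite ge0_fin_numE//; apply: le_lt_trans (nu_lty w t).
  by apply: le_measure; rewrite ?inE//; exact: mCt.
have past0 : predictable N (fun x => nu x.2 `]-oo, x.1[%classic).
  have /= := @predictable_left_limit setT setT measurableT.
  rewrite (_ : (fun x => _) = (fun x => nu x.2 `]-oo, x.1[%classic)); last first.
    by apply/funext => x; rewrite patchT ?inE// setTI.
  apply=> q; apply: adapted_at_restrict; last exact: historyT.
  by apply: adapted_nu; [rewrite setTI; exact: measurable_itv|rewrite setTI].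
pose Q (C' : set predSp) :=
  predictable N (fun x => nu x.2 ([set s | C' (s, x.2)] `&` `]-oo, x.1[)).
move: C; apply: (@dynkin_induction _ predSp (predictable_rectangles N) Q); rewrite /Q.
- by [].
- move=> _ _ [a [b [A [aA ->]]]] [a' [b' [A' [aA' ->]]]].
  exists (Num.max a a'), (Num.min b b'), (A `&` A'); split.
    by apply: historyI; [apply: sub_history aA|apply: sub_history aA'];
      rewrite le_max lexx ?orbT.
  apply/seteqP; split=> -[t w] /=; rewrite !in_itv/= gt_max le_min.
    by case=> -[/andP[-> ->] Aw] [/andP[-> ->] A'w].
  by case=> /andP[/andP[-> ->] /andP[-> ->]] [].
- rewrite (_ : (fun x => _) = (fun x => nu x.2 `]-oo, x.1[%classic)) //.
  by apply/funext => x; congr (nu _ _); apply/seteqP; split => // t [].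
- move=> _ [a [b [A [aA ->]]]].
  rewrite (_ : (fun x => _) = (fun x => ((fun w => nu w (`]a, b] `&` `]-oo, x.1[)) \_ A) x.2)).
    apply: predictable_left_limit => [|q]; first exact: measurable_itv.
    have [qa|aq] := leP q a.
      rewrite (_ : _ \_ A = cst 0); first exact: adapted_at_cst.
      apply/funext => w; rewrite patchE; case: ifPn => // _.
      rewrite (_ : _ `&` _ = set0) ?measure0//; apply/seteqP; split=> // s [/=].
      by rewrite !in_itv/= => /andP[as_ _] /(lt_le_trans as_); rewrite ltNge qa.
    apply: adapted_at_restrict; last by apply: sub_history aA; exact: ltW.
    apply: adapted_nu => //; apply: measurableI; exact: measurable_itv.
  apply/funext => -[t w] /=; rewrite patchE; case: ifPn => [/set_mem Aw|Aw].
    by congr (nu w (_ `&` _)); apply/seteqP; split=> [s []|s ?].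
  rewrite (_ : [set _ | _] = set0) ?set0I ?measure0//; apply/seteqP; split=> // s [].
  by move=> _ /= /mem_set; rewrite (negbTE Aw).
- move=> C' mC' pC'.
  rewrite (_ : (fun x => _) = fun x => nu x.2 `]-oo, x.1[%classic -
      nu x.2 ([set s | C' (s, x.2)] `&` `]-oo, x.1[)).
    exact: emeasurable_funB.
  apply/funext => -[t w] /=.
  rewrite [X in nu w X](_ : _ = `]-oo, t[%classic `\` ([set s | C' (s, w)] `&` `]-oo, t[)).
    rewrite measureD//; [|exact: mCt|exact: nu_lty].
    by congr (_ - nu w _); rewrite setIC -setIA setIid.
  by apply/seteqP; split=> s /=; tauto.
- move=> F mF tF pF.
  rewrite (_ : (fun x => _) = fun x =>
      \sum_(0 <= n <oo) nu x.2 ([set s | F n (s, x.2)] `&` `]-oo, x.1[)).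
    apply: (@ge0_emeasurable_sum _ predSp _ setT (fun n x =>
      nu x.2 ([set s | F n (s, x.2)] `&` `]-oo, x.1[)) xpredT) => [n x _ _|n _].
      exact: measure_ge0.
    exact: pF.
  apply/funext => -[t w] /=.
  rewrite [X in nu w X](_ : _ = \bigcup_n ([set s | F n (s, w)] `&` `]-oo, t[)).
    rewrite measure_bigcup//.
      by apply: eq_eseriesl => n; rewrite in_setT.
    by move=> n _; exact: mCt.
    apply/trivIsetP => i j _ _ ij; apply/seteqP; split=> // s [[/= Fi _] [/= Fj _]].
    by move/trivIsetP : tF => /(_ i j Logic.I Logic.I ij)/seteqP[/(_ (s, w) (conj Fi Fj))].
  by rewrite -setI_bigcupl; congr (_ `&` _); apply/seteqP.
Qed.

(** The past is taken strict: an atom of nu at the current time must not be seen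
    by a predictable process.  The integral is one against a kernel on the
    predictable space, namely nu restricted to (-oo, t) and transported to the
    line of the outcome w. *)
Lemma predictable_integral_past {K : R * Omega -> \bar R} :
  predictable N K -> (forall x, 0 <= K x) ->
  predictable N (fun x => \int[nu x.2]_(s in `]-oo, x.1[) K (s, x.2)).
Proof.
move=> pK K0.
have mitv (t : R) : measurable (`]-oo, t[ : set time) by exact: measurable_itv.
pose l (x : predSp) : {measure set predSp -> \bar R} :=
  pushforward (mrestr (nu x.2) (mitv x.1)) (fun s : time => (s, x.2) : predSp).
have ml (x : predSp) := measurable_pair_time x.2.
have := @measurable_fun_integral_kernel _ _ predSp predSp R (l ml) _ K K0 pK.
rewrite (_ : (fun x => _) = (fun x => \int[nu x.2]_(s in `]-oo, x.1[) K (s, x.2))).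
  apply=> C mC; exact: predictable_measure_past.
apply/funext => x; rewrite ge0_integral_pushforward//.
rewrite preimage_setT ge0_integral_mrestr//; last by move=> s; exact: K0.
exact: measurableT_comp pK (ml x).
Qed.

(** Monotone limit of the integrals over the past of the times n. *)
Lemma measurable_integral_outcome {K : R * Omega -> \bar R} :
  predictable N K -> (forall x, 0 <= K x) ->
  measurable_fun setT (fun w => \int[nu w]_s K (s, w)).
Proof.
move=> pK K0; pose F n : set time := `]-oo, n%:R[%classic.
apply: (emeasurable_fun_cvg (fun n w => \int[nu w]_(s in F n) K (s, w))).
  move=> n; have pJ := predictable_integral_past pK K0.
  exact: measurableT_comp pJ (measurable_pair_outcome n%:R).
move=> w _; have FT : \bigcup_n F n = setT.
  apply/seteqP; split=> // s _; exists (Num.truncn s).+1 => //=.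
  by rewrite /F/= in_itv/= Num.Theory.truncnS_gt.
rewrite -FT; apply: ge0_nondecreasing_set_cvg_integral => //.
- move=> m n mn; apply/subsetPset => s; rewrite /F/= !in_itv/= => /lt_le_trans; apply.
  by rewrite ler_nat.
- by move=> n; exact: measurable_itv.
- move=> n; apply: measurable_funTS.
  exact: measurableT_comp pK (measurable_pair_time w).
Qed.

End AdaptedMeasure.
End Predictability.

(** * Tonelli's theorem and splitting along the diagonal *)

Section Tonelli.
Local Open Scope ereal_scope.
Context {d1 d2 : measure_display} {T1 : measurableType d1} {T2 : measurableType d2}
  {R : realType}.
Context {m1 : {measure set T1 -> \bar R}} {m2 : {measure set T2 -> \bar R}}.

(** Sigma-finiteness is a hypothesis here, not a structure, because it will hold
    for the realizations of a point process one by one. *)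
Lemma tonelli (f : T1 -> T2 -> \bar R) : sigma_finite setT m1 -> sigma_finite setT m2 ->
  measurable_fun setT (fun z => f z.1 z.2) -> (forall x y, 0 <= f x y) ->
  \int[m1]_x \int[m2]_y f x y = \int[m2]_y \int[m1]_x f x y.
Proof.
move=> s1 s2 mf f0.
pose M1 : {sigma_finite_measure set T1 -> \bar R} :=
  HB.pack (Measure.sort m1) (isSFinite.Build _ _ _ (Measure.sort m1)
      (sfinite_measure_sigma_finite s1)) (isSigmaFinite.Build _ _ _ (Measure.sort m1) s1).
pose M2 : {sigma_finite_measure set T2 -> \bar R} :=
  HB.pack (Measure.sort m2) (isSFinite.Build _ _ _ (Measure.sort m2)
      (sfinite_measure_sigma_finite s2)) (isSigmaFinite.Build _ _ _ (Measure.sort m2) s2).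
exact: (@fubini_tonelli _ _ T1 T2 R M1 M2 (fun z => f z.1 z.2)).
Qed.

Lemma measurable_integral_param (f : T1 -> T2 -> \bar R) : sigma_finite setT m2 ->
  measurable_fun setT (fun z => f z.1 z.2) -> (forall x y, 0 <= f x y) ->
  measurable_fun setT (fun x => \int[m2]_y f x y).
Proof.
move=> s2 mf f0.
pose M2 : {sigma_finite_measure set T2 -> \bar R} :=
  HB.pack (Measure.sort m2) (isSFinite.Build _ _ _ (Measure.sort m2)
      (sfinite_measure_sigma_finite s2)) (isSigmaFinite.Build _ _ _ (Measure.sort m2) s2).
exact: (@measurable_fun_fubini_tonelli_F _ _ T1 T2 R M2 (fun z => f z.1 z.2)).
Qed.

End Tonelli.

Section SectionIntegral.
Local Open Scope ereal_scope.
Context {R : realType}.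
Local Notation time := (measurableTypeR R).
Context {m : {measure set time -> \bar R}}.
Hypothesis sfm : sigma_finite setT m.

Lemma measurable_lt_time : measurable [set z : time * time | (z.1 < z.2)%R].
Proof.
have := @measurable_fun_ltr _ _ R setT (@fst time time) (@snd time time)
  measurable_fst measurable_snd.
by move=> /(_ measurableT [set true] Logic.I); rewrite setTI.
Qed.

Lemma measurable_gt_time : measurable [set z : time * time | (z.2 < z.1)%R].
Proof.
have := @measurable_fun_ltr _ _ R setT (@snd time time) (@fst time time)
  measurable_snd measurable_fst.
by move=> /(_ measurableT [set true] Logic.I); rewrite setTI.
Qed.

Lemma integral_section (E : set (time * time)) (f : time -> \bar R) s :
  \int[m]_(t in [set t | E (s, t)]) f t = \int[m]_t ((fun z => f z.2) \_ E) (s, t).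
Proof.
rewrite integral_mkcond; apply: eq_integral => t _; rewrite !patchE/=.
by congr (if _ then _ else _); apply/idP/idP => /set_mem ?; exact/mem_set.
Qed.

Lemma measurable_section_fun {E : set (time * time)} {k : time * time -> \bar R} :
  measurable E -> measurable_fun setT k -> measurable_fun setT (k \_ E).
Proof.
by move=> mE mk; apply/(measurable_restrictT _ mE); exact: measurable_funTS.
Qed.

Lemma measurable_integral_section {E : set (time * time)} {f : time -> \bar R} :
  measurable E -> measurable_fun setT f -> (forall x, 0 <= f x) ->
  measurable_fun setT (fun s => \int[m]_(t in [set t | E (s, t)]) f t).
Proof.
move=> mE mf f0; under eq_fun do rewrite integral_section.
apply: (@measurable_integral_param _ _ time time R m
  (fun s t => ((fun z => f z.2) \_ E) (s, t)) sfm).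
  rewrite [X in measurable_fun _ X](_ : _ = (fun z => f z.2) \_ E); last by apply/funext => -[].
  by apply: measurable_section_fun => //; exact: measurableT_comp mf measurable_snd.
by move=> s t; rewrite patchE; case: ifP.
Qed.

Lemma measurable_integral_lt {f : time -> \bar R} :
  measurable_fun setT f -> (forall x, 0 <= f x) ->
  measurable_fun setT (fun t : R => \int[m]_(s in `]-oo, t[) f s).
Proof.
move=> mf f0; have := measurable_integral_section measurable_gt_time mf f0.
by congr measurable_fun; apply/funext => t; congr (integral _ _ _); apply/seteqP; split=> s;
  rewrite /= in_itv.
Qed.

Lemma measurable_integral_gt {f : time -> \bar R} :
  measurable_fun setT f -> (forall x, 0 <= f x) ->
  measurable_fun setT (fun s : R => \int[m]_(t in `]s, +oo[) f t).
Proof.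
move=> mf f0; have := measurable_integral_section measurable_lt_time mf f0.
by congr measurable_fun; apply/funext => t; congr (integral _ _ _); apply/seteqP; split=> s;
  rewrite /= in_itv/= andbT.
Qed.

Lemma measurable_integral_le {f : time -> \bar R} :
  measurable_fun setT f -> (forall x, 0 <= f x) ->
  measurable_fun setT (fun t : R => \int[m]_(s in `]-oo, t]) f s).
Proof.
move=> mf f0; have := measurable_integral_section (measurableC measurable_lt_time) mf f0.
by congr measurable_fun; apply/funext => t; congr (integral _ _ _); apply/seteqP; split=> s;
  rewrite /= in_itv/= leNgt => /negP.
Qed.

End SectionIntegral.

Section ProductFormula.
Local Open Scope ereal_scope.
Context {R : realType}.
Local Notation time := (measurableTypeR R).
Context {m1 m2 : {measure set time -> \bar R}}.
Hypotheses (sf1 : sigma_finite setT m1) (sf2 : sigma_finite setT m2).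
Context {f h : time -> \bar R}.
Hypotheses (mf : measurable_fun setT f) (f0 : forall x, 0 <= f x).
Hypotheses (mh : measurable_fun setT h) (h0 : forall x, 0 <= h x).

(** The two half-planes s < t and t <= s.  The asymmetry is deliberate: the
    first inner integral is over a strict past, and the closed past of the
    second one is compared with the strict one by the two lemmas on the
    diagonal below. *)
Lemma integral_product_split :
  (\int[m1]_s f s) * (\int[m2]_t h t) =
  \int[m2]_t (h t * \int[m1]_(s in `]-oo, t[) f s) +
  \int[m1]_s (f s * \int[m2]_(t in `]-oo, s]) h t).
Proof.
have mbefore := measurable_integral_le sf2 mh h0.
have mafter := measurable_integral_gt sf2 mh h0.
have after0 s : 0 <= \int[m2]_(t in `]s, +oo[) h t by exact: integral_ge0.
have before0 s : 0 <= \int[m2]_(t in `]-oo, s]) h t by exact: integral_ge0.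
rewrite -ge0_integralZr//; last exact: integral_ge0.
transitivity (\int[m1]_s (f s * \int[m2]_(t in `]s, +oo[) h t +
                          f s * \int[m2]_(t in `]-oo, s]) h t)).
  apply: eq_integral => s _; rewrite -ge0_muleDr//; congr (_ * _).
  rewrite -ge0_integral_setU//=; last 2 first.
  - by apply: measurable_funTS.
  - apply/disj_setPS => t [/=]; rewrite !in_itv/= andbT => st /(lt_le_trans st).
    by rewrite ltxx.
  congr (integral _ _ _); apply/seteqP; split=> // t _ /=.
  by rewrite !in_itv/= andbT; case: (ltP s t); [left|right].
rewrite ge0_integralD//; last 4 first.
- by move=> s _; rewrite mule_ge0.
- exact: emeasurable_funM.
- by move=> s _; rewrite mule_ge0.
- exact: emeasurable_funM.
congr (_ + _).
pose E := [set z : time * time | (z.1 < z.2)%R].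
have mE : measurable E by exact: measurable_lt_time.
pose k := (fun z : time * time => f z.1 * h z.2) \_ E.
have mfst := measurableT_comp mf (@measurable_fst _ _ time time).
have msnd := measurableT_comp mh (@measurable_snd _ _ time time).
transitivity (\int[m1]_s \int[m2]_t k (s, t)).
  apply: eq_integral => s _.
  rewrite (_ : `]s, +oo[%classic = [set t | E (s, t)]); last first.
    by apply/seteqP; split=> t; rewrite /= in_itv/= andbT.
  rewrite integral_section -ge0_integralZl//.
  - by apply: eq_integral => t _; rewrite /k !patchE; case: ifP => // _; rewrite mule0.
  - by have := measurable_section_fun mE msnd; move/(measurable_fun_pair2 s).
  - by move=> t _; rewrite patchE; case: ifP.
rewrite tonelli//; last 2 first.
- rewrite [X in measurable_fun _ X](_ : _ = k); last by apply/funext => -[].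
  by apply: measurable_section_fun => //; exact: emeasurable_funM.
- by move=> s t; rewrite /k patchE; case: ifP => // _; rewrite mule_ge0.
apply: eq_integral => t _.
rewrite -ge0_integralZl//; last by apply: measurable_funTS.
rewrite [RHS]integral_mkcond; apply: eq_integral => s _; rewrite /k !patchE.
have -> : (s \in `]-oo, t[%classic) = (s < t)%R by rewrite mem_setE in_itv.
case: ifPn => [/set_mem/= ->|/negP st]; first by rewrite muleC.
by rewrite ifF//; apply: contra_notF st => /mem_set.
Qed.

End ProductFormula.

(** * Point measures *)

Lemma finite_set_max {R : realType} (A : set R) : finite_set A -> A !=set0 ->
  exists2 z, A z & forall x, A x -> x <= z.
Proof.
move=> finA [x0 Ax0].
pose s : seq R := finmap.enum_fset (fset_set A).
have sA x : (x \in s) = (x \in A) by exact: in_fset_set.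
have : s != [::] by apply/eqP => s0; have := sA x0; rewrite s0 mem_set.
suff H : s != [::] -> exists2 z, z \in s & forall x, x \in s -> x <= z.
  move=> /H[z zs sz]; exists z; first by apply/set_mem; rewrite -sA.
  by move=> x Ax; apply: sz; rewrite sA mem_set.
elim: (s) => // a [_ _|b l /(_ isT)[z zl lz] _].
  by exists a => [|x]; rewrite inE// => /eqP ->.
have [az|za] := leP a z.
  by exists z => [|x]; rewrite inE ?zl ?orbT// => /predU1P[->//|/lz].
exists a => [|x]; first by rewrite inE eqxx.
by rewrite inE => /predU1P[->//|/lz/le_trans]; apply; exact: ltW.
Qed.

Section PointMeasure.
Context {R : realType}.
Local Notation time := (measurableTypeR R).
Context {m : {measure set time -> \bar R}} {X : set R}.
Hypothesis finX : forall b : R, finite_set (X `&` `]-oo, b]).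
Hypothesis mE : forall B : set time, measurable B -> m B = counting (X `&` B).

Lemma points_countable : countable X.
Proof.
have -> : X = \bigcup_n (X `&` `]-oo, n%:R]).
  apply/seteqP; split=> [s Xs|s [n _ []]//].
  exists (Num.truncn s).+1 => //; split=> //=; rewrite in_itv/= ltW//.
  exact: Num.Theory.truncnS_gt.
by apply: bigcup_countable => // n _; exact: finite_set_countable.
Qed.

Lemma measurable_points : measurable (X : set time).
Proof.
by apply: countable_measurable points_countable => t; exact: measurable_set1.
Qed.

Lemma point_measure_lty (b : R) : (m `]-oo, b]%classic < +oo)%E.
Proof. by rewrite mE// /counting asboolT// ltry. Qed.

Lemma point_measure_past_lty (b : R) : (m `]-oo, b[%classic < +oo)%E.
Proof.
apply: le_lt_trans (point_measure_lty b); apply: le_measure; rewrite ?inE//.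
by move=> s /=; rewrite !in_itv/=; exact: ltW.
Qed.

Lemma point_measure_sigma_finite : sigma_finite setT m.
Proof.
exists (fun n => `]-oo, n%:R]%classic).
  apply/seteqP; split=> // s _; exists (Num.truncn s).+1 => //=.
  by rewrite in_itv/= ltW// Num.Theory.truncnS_gt.
by move=> n; split=> //; exact: point_measure_lty.
Qed.

Lemma point_measure_atom s : X s -> m [set s] = 1%E.
Proof.
move=> Xs; rewrite mE// setIidr; last by move=> _ ->.
by rewrite /counting asboolT// fset_set1 finmap.cardfs1.
Qed.

Lemma point_measure_off : m (~` X) = 0%E.
Proof.
rewrite mE; last by apply: measurableC; exact: measurable_points.
by rewrite setICr /counting asboolT// fset_set0 finmap.cardfs0.
Qed.

(** One list of points serves all integrands; this is what makes the
    log-likelihood, as a function of the parameters, a sum over a fixed list. *)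
Lemma ge0_integral_points (D : set time) (b : R) : measurable D -> D `<=` `]-oo, b] ->
  exists2 s : seq R, (forall x, x \in s -> X x /\ D x) &
    forall f : time -> \bar R, measurable_fun D f -> (forall x, D x -> 0 <= f x)%E ->
      (\int[m]_(x in D) f x = \sum_(x <- s) f x)%E.
Proof.
move=> mD Db.
have finXD : finite_set (X `&` D).
  by apply: sub_finite_set (finX b) => s [Xs /Db ?]; split.
pose s : seq R := finmap.enum_fset (fset_set (X `&` D)).
have sP x : x \in s -> X x /\ D x.
  by have := in_fset_set finXD x; rewrite /s => -> /set_mem.
exists s => // f mf f0.
pose delta (i : nat) : {measure set time -> \bar R} := @dirac _ time (nth 0 s i) R.
rewrite (@eq_measure_integral _ _ _ _ (msum delta (size s))).
  rewrite ge0_integral_measure_sum// (big_nth 0) big_mkord; apply: eq_bigr => i _.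
  rewrite integral_dirac// diracE mem_set ?mul1e//.
  by have [] := sP (nth 0 s i) (mem_nth _ (ltn_ord i)).
move=> A mA AD.
have finXA : finite_set (X `&` A).
  by apply: sub_finite_set finXD => x [Xx /AD].
rewrite mE// /counting asboolT// /msum/=.
transitivity (\sum_(x <- s) (x \in A)%:R%:E : \bar R)%E; last first.
  by rewrite (big_nth 0) big_mkord; apply: eq_bigr => i _; rewrite /delta/= diracE.
rewrite sumEFin; congr EFin; rewrite -natr_sum; congr _%:R.
rewrite -big_mkcond/= sum1_count -size_filter; apply: perm_size.
apply: uniq_perm => [||x]; [exact: finmap.fset_uniq|exact/filter_uniq/finmap.fset_uniq|].
rewrite mem_filter (in_fset_set finXA) (in_fset_set finXD); apply/idP/idP.
  by move=> /set_mem[Xx Ax]; apply/andP; split; apply/mem_set => //; split=> //; exact: AD.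
by move=> /andP[/set_mem Ax /set_mem[Xx _]]; exact/mem_set.
Qed.

Lemma Rintegral_points (D : set time) (b : R) : measurable D -> D `<=` `]-oo, b] ->
  exists2 s : seq R, (forall x, x \in s -> X x /\ D x) &
    forall f : time -> R, measurable_fun D f ->
      \int[m]_(x in D) f x = \sum_(x <- s) f x.
Proof.
move=> mD Db; have [s sP sE] := ge0_integral_points _ _ mD Db.
exists s => // f mf; rewrite /Rintegral integralE !sE//; last 2 first.
- by apply: measurable_funeneg; exact/measurable_EFinP.
- by apply: measurable_funepos; exact/measurable_EFinP.
rewrite (eq_bigr (fun x => (Num.max (f x) 0)%:E)); last by move=> x _; rewrite funeposE EFin_max.
rewrite [X in (_ - X)%E](eq_bigr (fun x => (Num.max (- f x) 0)%:E)); last first.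
  by move=> x _; rewrite funenegE EFin_max EFinN.
rewrite !sumEFin -EFinB/= -sumrB; apply: eq_bigr => x _.
have [fx|fx] := leP 0 (f x); first by rewrite max_r ?oppr_le0// subr0.
by rewrite max_l ?oppr_ge0 ?ltW// opprK add0r.
Qed.

(** The atoms have mass one, so closing the past of s at an atom s adds h s. *)
Lemma integral_points_diagonal (f h : time -> \bar R) :
  measurable_fun setT f -> (forall x, 0 <= f x)%E ->
  measurable_fun setT h -> (forall x, 0 <= h x)%E ->
  (\int[m]_s (f s * \int[m]_(t in `]-oo, s]) h t) =
   \int[m]_s (f s * \int[m]_(t in `]-oo, s[) h t) + \int[m]_s (f s * h s))%E.
Proof.
move=> mf f0 mh h0.
have past0 s : (0 <= \int[m]_(t in `]-oo, s[) h t)%E by exact: integral_ge0.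
have mpast : measurable_fun setT (fun s : R => \int[m]_(t in `]-oo, s[) h t)%E.
  exact: (measurable_integral_lt point_measure_sigma_finite mh h0).
rewrite -ge0_integralD//; last 4 first.
- by move=> s _; rewrite mule_ge0.
- exact: emeasurable_funM.
- by move=> s _; rewrite mule_ge0.
- exact: emeasurable_funM.
rewrite [LHS](ge0_negligible_integral _ _ _ _ point_measure_off)//; last 3 first.
- by apply: measurableC; exact: measurable_points.
- apply: emeasurable_funM => //.
  exact: (measurable_integral_le point_measure_sigma_finite mh h0).
- by move=> s _; rewrite mule_ge0// integral_ge0.
rewrite [RHS](ge0_negligible_integral _ _ _ _ point_measure_off)//; last 3 first.
- by apply: measurableC; exact: measurable_points.
- by apply: emeasurable_funD; exact: emeasurable_funM.
- by move=> s _; rewrite adde_ge0// mule_ge0.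
rewrite setTD setCK; apply: eq_integral => s /set_mem Xs.
rewrite -ge0_muleDr//; congr (_ * _)%E.
rewrite (_ : `]-oo, s]%classic = `]-oo, s[ `|` [set s]); last first.
  by rewrite setUitv1.
rewrite ge0_integral_setU//.
- congr (_ + _)%E; rewrite (eq_integral (cst (h s))); last by move=> t /set_mem ->.
  by rewrite integral_cst// point_measure_atom// mule1.
- by apply: measurable_funTS.
- by apply/disj_setPS => t [/= + ts]; rewrite ts in_itv/= ltxx.
Qed.

(** The last point z of A has at most n points before it, by the hypothesis at
    z itself, and all the other points of A are among those. *)
Lemma point_measure_capped (A : set time) (b : R) (n : nat) : measurable A ->
  A `<=` `]-oo, b] -> (forall t, A t -> m `]-oo, t[%classic <= n%:R%:E)%E ->
  (m A <= n.+1%:R%:E)%E.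
Proof.
move=> mA Ab An.
have finXA : finite_set (X `&` A) by apply: sub_finite_set (finX b) => s [Xs /Ab].
have mXA : m A = m (X `&` A).
  by rewrite !mE ?setIA ?setIid//; apply: measurableI => //; exact: measurable_points.
rewrite mXA; have [->|/set0P XA] := eqVneq (X `&` A) set0.
  by rewrite measure0 lee_fin.
have [z [Xz Az] zmax] := finite_set_max _ finXA XA.
have mz : measurable (`]-oo, z[ : set time) by exact: measurable_itv.
apply: (@le_trans _ _ (m (`]-oo, z[ `|` [set z]))).
  apply: le_measure; rewrite ?inE//.
  - by apply: measurableI => //; exact: measurable_points.
  - exact: measurableU.
  - by move=> x /zmax; rewrite /= in_itv/= le_eqVlt => /predU1P[->|]; [right|left].
apply: le_trans (measureU2 _ _ _) _ => //.
rewrite [X in (_ + X)%E](point_measure_atom _ Xz) -natr1 EFinD leeD2r//.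
exact: An.
Qed.

End PointMeasure.

(** * Lebesgue measure after the starting time *)

Section LebesgueAfter.
Local Open Scope ereal_scope.
Context {R : realType} (s0 : R).
Local Notation time := (measurableTypeR R).

(** Having the restriction to (s0, +oo) as a measure on the whole line lets the
    compensator be treated on the same footing as the point process. *)
Definition lebesgue_after : {measure set time -> \bar R} :=
  mrestr lebesgue_measure (measurable_itv `]s0, +oo[).
Local Notation m0 := lebesgue_after.

Lemma integral_lebesgue_after (f : time -> \bar R) :
  measurable_fun setT f -> (forall x, 0 <= f x) ->
  \int[m0]_t f t = \int[lebesgue_measure]_(t in `]s0, +oo[) f t.
Proof. by move=> mf f0; rewrite [LHS]ge0_integral_mrestr. Qed.

Lemma lebesgue_after_lty (b : R) : m0 `]-oo, b]%classic < +oo.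
Proof.
rewrite /lebesgue_after/= /mrestr.
rewrite (_ : _ `&` _ = `]s0, b]%classic); last first.
  by apply/seteqP; split=> t /=; rewrite !in_itv/= andbT; [move=> [-> ->]|move=> /andP[-> ->]].
by rewrite lebesgue_measure_itv/=; case: ifPn => // _; rewrite -EFinB ltry.
Qed.

Lemma lebesgue_after_past_lty (b : R) : m0 `]-oo, b[%classic < +oo.
Proof.
apply: le_lt_trans (lebesgue_after_lty b); apply: le_measure; rewrite ?inE//.
by move=> s /=; rewrite !in_itv/=; exact: ltW.
Qed.

Lemma lebesgue_after_sigma_finite : sigma_finite setT m0.
Proof.
exists (fun n => `]-oo, n%:R]%classic).
  apply/seteqP; split=> // s _; exists (Num.truncn s).+1 => //=.
  by rewrite in_itv/= ltW// Num.Theory.truncnS_gt.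
by move=> n; split; [exact: measurable_itv|exact: lebesgue_after_lty].
Qed.

(** Lebesgue measure does not charge the endpoint s. *)
Lemma lebesgue_after_past_closed {f : time -> \bar R} {s : R} :
  measurable_fun setT f -> (forall x, 0 <= f x) ->
  \int[m0]_(t in `]-oo, s]) f t = \int[m0]_(t in `]-oo, s[) f t.
Proof.
move=> mf f0; rewrite (_ : `]-oo, s]%classic = `]-oo, s[ `|` [set s]); last first.
  by rewrite setUitv1.
rewrite ge0_integral_setU//.
- rewrite [X in _ + X](eq_integral (cst (f s))); last by move=> t /set_mem ->.
  have m0s : m0 [set s] = 0.
    apply/eqP; rewrite eq_le measure_ge0 andbT -(lebesgue_measure_set1 s).
    by apply: le_measure; rewrite ?inE//; apply: measurableI => //; exact: measurable_itv.
  by rewrite integral_cst//= m0s mule0 adde0.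
- by apply: measurable_funTS.
- by apply/disj_setPS => t [/= + ts]; rewrite ts in_itv/= ltxx.
Qed.

End LebesgueAfter.

(** * The isometry for compensated integrals *)

Section CompensatedIntegral.
Local Open Scope ereal_scope.
Context {d : measure_display} {Omega : measurableType d} {R : realType}
  {P : probability Omega R} {N : R.-ker Omega ~> (measurableTypeR R)}
  {s0 : R} {lambda : R -> Omega -> R}.
Local Notation time := (measurableTypeR R).
Local Notation m0 := (lebesgue_after s0).
Hypothesis pointN : simple_point_process N s0.
Hypothesis intensityN : stochastic_intensity P N s0 lambda.

Lemma adapted_point_process t (B : set time) : measurable B -> B `<=` `]-oo, t] ->
  adapted_at N t (fun w => N w B).
Proof. by move=> mB Bt U mU; apply: sub_sigma_algebra; exists B, U. Qed.

Lemma adapted_lebesgue_after t (B : set time) : measurable B -> B `<=` `]-oo, t] ->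
  adapted_at N t (fun w : Omega => m0 B).
Proof. by move=> _ _; exact: adapted_at_cst. Qed.

Lemma point_process_past_lty w (b : R) : N w `]-oo, b[%classic < +oo.
Proof. by have [X [_ finX NE]] := pointN w; exact: point_measure_past_lty finX NE b. Qed.

Lemma point_process_sigma_finite w : sigma_finite setT (N w).
Proof. by have [X [_ finX NE]] := pointN w; exact: point_measure_sigma_finite finX NE. Qed.

Lemma integral_point_process w (f : time -> \bar R) :
  measurable_fun setT f -> (forall x, 0 <= f x) ->
  \int[N w]_t f t = \int[N w]_(t in `]s0, +oo[) f t.
Proof.
move=> mf f0; have [X [Xs0 finX NE]] := pointN w.
have ms0 : measurable (`]s0, +oo[ : set time) by exact: measurable_itv.
rewrite [LHS](@ge0_negligible_integral _ time _ _ setT (~` `]s0, +oo[%classic))//.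
- by rewrite setTD setCK.
- exact: measurableC.
- have := NE _ (measurableC ms0); rewrite (_ : _ `&` _ = set0) ?measure0//.
  by apply/seteqP; split=> // t [/Xs0].
Qed.

Lemma measurable_pathwise {K : R * Omega -> \bar R} w :
  predictable N K -> measurable_fun setT (fun t : time => K (t, w)).
Proof. by move=> pK; exact: measurableT_comp pK (measurable_pair_time N w). Qed.

Lemma expectation_intensity (C : R * Omega -> \bar R) : predictable N C ->
  (forall x, 0 <= C x) ->
  \int[P]_w \int[N w]_t C (t, w) = \int[P]_w \int[m0]_t (C (t, w) * (lambda t w)%:E).
Proof.
move=> pC C0; have [l0 pl _ /(_ C pC C0) CE] := intensityN.
transitivity (\int[P]_w \int[N w]_(t in `]s0, +oo[) C (t, w)).
  apply: eq_integral => w _; rewrite integral_point_process//.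
  exact: measurable_pathwise.
rewrite CE; apply: eq_integral => w _; rewrite integral_lebesgue_after//.
- apply: emeasurable_funM; first exact: measurable_pathwise.
  exact: (measurable_pathwise w pl).
- by move=> t; rewrite mule_ge0// lee_fin.
Qed.

Let predictableM (F G : R * Omega -> \bar R) : predictable N F -> predictable N G ->
  predictable N (fun x => F x * G x).
Proof. by move=> pF pG; exact: emeasurable_funM. Qed.

Let predictable_past_N {K : R * Omega -> \bar R} : predictable N K -> (forall x, 0 <= K x) ->
  predictable N (fun x => \int[N x.2]_(s in `]-oo, x.1[) K (s, x.2)).
Proof.
move=> pK K0; apply: (predictable_integral_past N N) => //.
- exact: adapted_point_process.
- exact: point_process_past_lty.
Qed.

Let predictable_past_m0 {K : R * Omega -> \bar R} : predictable N K -> (forall x, 0 <= K x) ->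
  predictable N (fun x => \int[m0]_(s in `]-oo, x.1[) K (s, x.2)).
Proof.
move=> pK K0; apply: (predictable_integral_past N (fun _ => m0)) => //.
- exact: adapted_lebesgue_after.
- by move=> _; exact: lebesgue_after_past_lty.
Qed.

Lemma measurable_integral_N (K : R * Omega -> \bar R) : predictable N K ->
  (forall x, 0 <= K x) -> measurable_fun setT (fun w => \int[N w]_s K (s, w)).
Proof.
move=> pK K0; apply: (measurable_integral_outcome N N) => //.
- exact: adapted_point_process.
- exact: point_process_past_lty.
Qed.

Lemma measurable_integral_m0 (K : R * Omega -> \bar R) : predictable N K ->
  (forall x, 0 <= K x) -> measurable_fun setT (fun w => \int[m0]_s K (s, w)).
Proof.
move=> pK K0; apply: (measurable_integral_outcome N (fun _ => m0)) => //.
- exact: adapted_lebesgue_after.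
- by move=> _; exact: lebesgue_after_past_lty.
Qed.

Section Isometry.
Variable H : R * Omega -> \bar R.
Hypotheses (pH : predictable N H) (H0 : forall x, 0 <= H x).
Let K x := H x * (lambda x.1 x.2)%:E.
Let U w := \int[N w]_t H (t, w).
Let B w := \int[m0]_t K (t, w).

Let pl : predictable N (fun x => (lambda x.1 x.2)%:E).
Proof. by have [] := intensityN. Qed.

Let pK : predictable N K. Proof. exact: predictableM. Qed.

Let K0 x : 0 <= K x.
Proof. by have [l0 _ _ _] := intensityN; rewrite mule_ge0// lee_fin. Qed.

(** This is E (U - B)^2 = E int H^2 lambda with the subtractions moved across, so
    that all terms are nonnegative and no integrability is required.  Splitting
    U U, U B and B B along the diagonal leaves integrals of H or K against a
    predictable past integral, plus the diagonal of N x N, which is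
    int H^2 dN. *)
Lemma expectation_square_identity :
  \int[P]_w (U w * U w) + \int[P]_w (B w * B w) =
  \int[P]_w (U w * B w) + \int[P]_w (U w * B w) +
  \int[P]_w \int[m0]_t (H (t, w) * K (t, w)).
Proof.
pose JH x := \int[N x.2]_(s in `]-oo, x.1[) H (s, x.2).
pose JK x := \int[m0]_(s in `]-oo, x.1[) K (s, x.2).
have pJH : predictable N JH by exact: predictable_past_N.
have pJK : predictable N JK by exact: predictable_past_m0.
have JH0 x : 0 <= JH x by exact: integral_ge0.
have JK0 x : 0 <= JK x by exact: integral_ge0.
have mH w := measurable_pathwise w pH.
have mK w := measurable_pathwise w pK.
have closedK w s : \int[m0]_(t in `]-oo, s]) K (t, w) = JK (s, w).
  exact: (lebesgue_after_past_closed s0 (mK w) (fun t => K0 (t, w))).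
have closedNK w : \int[N w]_s (H (s, w) * \int[m0]_(t in `]-oo, s]) K (t, w)) =
    \int[N w]_s (H (s, w) * JK (s, w)).
  by apply: eq_integral => s _; rewrite closedK.
have closedKK w : \int[m0]_s (K (s, w) * \int[m0]_(t in `]-oo, s]) K (t, w)) =
    \int[m0]_s (K (s, w) * JK (s, w)).
  by apply: eq_integral => s _; rewrite closedK.
have UU w : U w * U w = \int[N w]_t (H (t, w) * JH (t, w)) +
    \int[N w]_t (H (t, w) * JH (t, w)) + \int[N w]_t (H (t, w) * H (t, w)).
  rewrite (integral_product_split (point_process_sigma_finite w)
    (point_process_sigma_finite w) (mH w) (fun t => H0 (t, w)) (mH w) (fun t => H0 (t, w))).
  have [X [_ finX NE]] := pointN w.
  by rewrite (integral_points_diagonal finX NE)// addeA.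
have UB w : U w * B w = \int[m0]_t (K (t, w) * JH (t, w)) +
    \int[N w]_t (H (t, w) * JK (t, w)).
  rewrite (integral_product_split (point_process_sigma_finite w)
    (lebesgue_after_sigma_finite s0) (mH w) (fun t => H0 (t, w)) (mK w) (fun t => K0 (t, w))).
  by rewrite closedNK.
have BB w : B w * B w = \int[m0]_t (K (t, w) * JK (t, w)) +
    \int[m0]_t (K (t, w) * JK (t, w)).
  rewrite (integral_product_split (lebesgue_after_sigma_finite s0)
    (lebesgue_after_sigma_finite s0) (mK w) (fun t => K0 (t, w)) (mK w) (fun t => K0 (t, w))).
  by rewrite closedKK.
(* The intensity property reduces all the terms to a, c and q:
   E UU = 2 a + q, E UB = a + c and E BB = 2 c. *)
pose a := \int[P]_w \int[m0]_t (K (t, w) * JH (t, w)).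
pose c := \int[P]_w \int[m0]_t (K (t, w) * JK (t, w)).
pose q := \int[P]_w \int[m0]_t (H (t, w) * K (t, w)).
have HJH0 x : 0 <= H x * JH x by rewrite mule_ge0.
have HH0 x : 0 <= H x * H x by rewrite mule_ge0.
have HJK0 x : 0 <= H x * JK x by rewrite mule_ge0.
have KJH0 x : 0 <= K x * JH x by rewrite mule_ge0.
have KJK0 x : 0 <= K x * JK x by rewrite mule_ge0.
have pHJH : predictable N (fun x => H x * JH x) by exact: predictableM.
have pHH : predictable N (fun x => H x * H x) by exact: predictableM.
have pHJK : predictable N (fun x => H x * JK x) by exact: predictableM.
have pKJH : predictable N (fun x => K x * JH x) by exact: predictableM.
have pKJK : predictable N (fun x => K x * JK x) by exact: predictableM.
have mHJH := measurable_integral_N _ pHJH HJH0.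
have mHH := measurable_integral_N _ pHH HH0.
have mHJK := measurable_integral_N _ pHJK HJK0.
have mKJH := measurable_integral_m0 _ pKJH KJH0.
have mKJK := measurable_integral_m0 _ pKJK KJK0.
have iHJH w : 0 <= \int[N w]_t (H (t, w) * JH (t, w)) by exact: integral_ge0.
have iHH w : 0 <= \int[N w]_t (H (t, w) * H (t, w)) by exact: integral_ge0.
have iHJK w : 0 <= \int[N w]_t (H (t, w) * JK (t, w)) by exact: integral_ge0.
have iKJH w : 0 <= \int[m0]_t (K (t, w) * JH (t, w)) by exact: integral_ge0.
have iKJK w : 0 <= \int[m0]_t (K (t, w) * JK (t, w)) by exact: integral_ge0.
have eHJH : \int[P]_w \int[N w]_t (H (t, w) * JH (t, w)) = a.
  rewrite (expectation_intensity _ pHJH HJH0); apply: eq_integral => w _.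
  by apply: eq_integral => t _; rewrite /K muleAC.
have eHH : \int[P]_w \int[N w]_t (H (t, w) * H (t, w)) = q.
  rewrite (expectation_intensity _ pHH HH0); apply: eq_integral => w _.
  by apply: eq_integral => t _; rewrite /K muleA.
have eHJK : \int[P]_w \int[N w]_t (H (t, w) * JK (t, w)) = c.
  rewrite (expectation_intensity _ pHJK HJK0); apply: eq_integral => w _.
  by apply: eq_integral => t _; rewrite /K muleAC.
have -> : \int[P]_w (U w * U w) = a + a + q.
  have mHJHD := emeasurable_funD mHJH mHJH.
  have iHJHD w := adde_ge0 (iHJH w) (iHJH w).
  rewrite -eHJH -eHH -(ge0_integralDT mHJH iHJH mHJH iHJH) -(ge0_integralDT mHJHD iHJHD mHH iHH).
  by apply: eq_integral => w _; exact: UU.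
have -> : \int[P]_w (U w * B w) = a + c.
  rewrite -eHJK -(ge0_integralDT mKJH iKJH mHJK iHJK).
  by apply: eq_integral => w _; exact: UB.
have -> : \int[P]_w (B w * B w) = c + c.
  rewrite -(ge0_integralDT mKJK iKJK mKJK iKJK).
  by apply: eq_integral => w _; exact: BB.
by rewrite -/q addeAC [in RHS]addeACA.
Qed.

(** Once the squares are integrable the identity can be solved for E (u - b)^2,
    and E u = E b by the intensity property. *)
Lemma variance_compensated (u b : Omega -> R) :
  (forall w, U w = (u w)%:E) -> (forall w, B w = (b w)%:E) ->
  \int[P]_w ((u w) ^+ 2)%:E < +oo -> \int[P]_w ((b w) ^+ 2)%:E < +oo ->
  [/\ b \in Lfun P 2%:E, (u \- b)%R \in Lfun P 2%:E,
      \int[P]_w ((u w - b w) ^+ 2)%:E = \int[P]_w \int[m0]_t (H (t, w) * K (t, w)) &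
      'V_P[(u \- b)%R] = \int[P]_w \int[m0]_t (H (t, w) * K (t, w))].
Proof.
move=> Uu Bb u2 b2.
have u0 w : (0 <= u w)%R by rewrite -lee_fin -Uu integral_ge0.
have b0 w : (0 <= b w)%R by rewrite -lee_fin -Bb integral_ge0.
have mu_ : measurable_fun setT u.
  apply/measurable_EFinP; rewrite (_ : _ \o _ = U); last by apply/funext => w; rewrite Uu.
  exact: measurable_integral_N.
have mb : measurable_fun setT b.
  apply/measurable_EFinP; rewrite (_ : _ \o _ = B); last by apply/funext => w; rewrite Bb.
  exact: measurable_integral_m0.
have mE (f : Omega -> R) : measurable_fun setT f -> measurable_fun setT (fun w => (f w)%:E).
  by move=> mf; exact/measurable_EFinP.
have mu2 := mE _ (measurable_funX 2 mu_).
have mb2 := mE _ (measurable_funX 2 mb).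
have mub := mE _ (measurable_funM mu_ mb).
have mX := mE _ (measurable_funX 2 (measurable_funB mu_ mb)).
have sq0 (f : Omega -> R) w : 0 <= (f w ^+ 2)%:E by rewrite lee_fin sqr_ge0.
have ub0 w : 0 <= (u w * b w)%:E by rewrite lee_fin mulr_ge0.
pose q := \int[P]_w \int[m0]_t (H (t, w) * K (t, w)).
pose e := \int[P]_w (u w * b w)%:E.
have id1 : \int[P]_w (u w ^+ 2)%:E + \int[P]_w (b w ^+ 2)%:E = e + e + q.
  have := expectation_square_identity; rewrite -/q.
  rewrite (_ : \int[P]_w (U w * U w) = \int[P]_w (u w ^+ 2)%:E); last first.
    by apply: eq_integral => w _; rewrite Uu -EFinM.
  rewrite (_ : \int[P]_w (B w * B w) = \int[P]_w (b w ^+ 2)%:E); last first.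
    by apply: eq_integral => w _; rewrite Bb -EFinM.
  rewrite (_ : \int[P]_w (U w * B w) = e)//.
  by apply: eq_integral => w _; rewrite Uu Bb -EFinM.
have id2 : \int[P]_w (u w ^+ 2)%:E + \int[P]_w (b w ^+ 2)%:E =
    e + e + \int[P]_w ((u w - b w) ^+ 2)%:E.
  have sX := sq0 (u \- b)%R.
  rewrite -(ge0_integralDT mu2 (sq0 u) mb2 (sq0 b)) -(ge0_integralDT mub ub0 mub ub0).
  rewrite -(ge0_integralDT (emeasurable_funD mub mub)
    (fun w => adde_ge0 (ub0 w) (ub0 w)) mX sX).
  by apply: eq_integral => w _; rewrite -!EFinD; congr EFin => /=; ring.
have e0 : 0 <= e by exact: integral_ge0.
have e_fin : e + e \is a fin_num.
  rewrite (ge0_fin_numE (adde_ge0 e0 e0)).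
  apply: le_lt_trans (lte_add_pinfty u2 b2); rewrite id1 leeDl//.
  by apply: integral_ge0 => w _; apply: integral_ge0 => t _; rewrite mule_ge0.
have X2 : \int[P]_w ((u w - b w) ^+ 2)%:E = q.
  by have := @addeK _ (e + e) q e_fin; rewrite (addeC q) -id1 id2 (addeC (e + e)) addeK.
have Lu : u \in Lfun P 2%:E by exact: Lfun2P.
have Lb : b \in Lfun P 2%:E by exact: Lfun2P.
have L1 f : f \in Lfun P 2%:E -> f \in Lfun P 1.
  by apply: Lfun_subset12; exact: fin_num_measure.
have LX : (u \- b)%R \in Lfun P 2%:E by rewrite rpredB ?lee1n.
split=> //; rewrite varianceE// expectationB ?L1//.
rewrite (_ : 'E_P[u] = 'E_P[b]); last first.
  rewrite unlock (_ : \int[P]_w (u w)%:E = \int[P]_w U w).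
    rewrite expectation_intensity//; apply: eq_integral => w _.
    by rewrite -Bb.
  by apply: eq_integral => w _; rewrite Uu.
rewrite subee ?expectation_fin_num ?L1// expe2 mule0 sube0 -/q -X2 unlock.
by apply: eq_integral.
Qed.

End Isometry.
End CompensatedIntegral.

(** * Excitation and its adjoint *)

Section Excitation.
Local Open Scope ereal_scope.
Context {d : measure_display} {Omega : measurableType d} {R : realType}
  {N : R.-ker Omega ~> (measurableTypeR R)} {g : R -> R} {s0 : R}.
Local Notation time := (measurableTypeR R).
Local Notation m0 := (lebesgue_after s0).
Hypothesis shape_g : kernel_shape g.
Hypothesis pointN : simple_point_process N s0.

(** The kernel g extended by 0, including at lag 0: the intensity at t ignores a
    point at t. *)
Definition memory (u : time) : \bar R := ((EFin \o g) \_ `]0%R, +oo[) u.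

Lemma memory_ge0 u : 0 <= memory u.
Proof.
have [_ g0 _] := shape_g.
rewrite /memory patchE mem_setE in_itv/= andbT; case: ifPn => // u0.
by rewrite lee_fin g0// ltW.
Qed.

Lemma measurable_memory : measurable_fun setT memory.
Proof.
have [mg _ _] := shape_g.
have mpos : measurable (`]0%R, +oo[ : set time) by exact: measurable_itv.
apply/(measurable_restrictT _ mpos).
apply/measurable_EFinP; apply: measurable_funS mg; first exact: measurable_itv.
by move=> u /=; rewrite !in_itv/= !andbT; exact: ltW.
Qed.

Lemma integral_memory : \int[lebesgue_measure]_u memory u = 1.
Proof.
have [mg _ <-] := shape_g; rewrite -integral_mkcond integral_itv_obnd_cbnd//.
apply/measurable_EFinP; apply: measurable_funS mg; first exact: measurable_itv.
by move=> u /=; rewrite !in_itv/= !andbT; exact: ltW.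
Qed.

Lemma measurable_memory_lag (t : R) : measurable_fun setT (fun s : time => memory (t - s)%R).
Proof.
apply: (measurableT_comp measurable_memory).
exact: (measurable_funB (measurable_cst t) (@measurable_id _ time setT)).
Qed.

Definition excitation (t : R) (w : Omega) : R :=
  (\int[N w]_(s in `]s0, t[) g (t - s))%R.

(** A point process has finitely many points in (s0, t), so the real integral
    loses nothing. *)
Lemma excitationE (t : R) w : (excitation t w)%:E = \int[N w]_s memory (t - s)%R.
Proof.
have [X [_ finX NE]] := pointN w.
have mD : measurable (`]s0, t[ : set time) by exact: measurable_itv.
have -> : \int[N w]_s memory (t - s)%R = \int[N w]_(s in `]s0, t[) (g (t - s))%:E.
  rewrite (integral_point_process pointN w _ (measurable_memory_lag t)
    (fun s => memory_ge0 (t - s)%R)).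
  rewrite integral_mkcond [RHS]integral_mkcond; apply: eq_integral => s _.
  rewrite /memory !patchE !mem_setE !in_itv/= !andbT subr_gt0.
  by case: (_ < s)%R.
rewrite /excitation /Rintegral fineK//.
have Db : `]s0, t[ `<=` (`]-oo, t] : set time).
  by move=> s /=; rewrite !in_itv/= => /andP[_ /ltW].
have [sq sqP sqE] := ge0_integral_points finX NE _ _ mD Db.
rewrite sqE ?sumEFin//.
  apply: eq_measurable_fun (measurable_funTS (measurable_memory_lag t)) => s.
  rewrite inE/= in_itv/= => /andP[_ st].
  by rewrite /memory patchE mem_setE in_itv/= andbT subr_gt0 st.
by have [_ g0 _] := shape_g; move=> s /=; rewrite in_itv/= => /andP[_ /ltW st];
  rewrite lee_fin g0// subr_ge0.
Qed.

Lemma excitation_ge0 t w : (0 <= excitation t w)%R.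
Proof. by rewrite -lee_fin excitationE integral_ge0// => s _; exact: memory_ge0. Qed.

Lemma lebesgue_translation (s : R) (A : set time) : measurable A ->
  lebesgue_measure A = pushforward lebesgue_measure (fun u : time => (u + s)%R : time) A.
Proof.
have ms : measurable_fun setT (fun u : time => (u + s)%R : time).
  exact: (measurable_funD (@measurable_id _ time setT) (measurable_cst s)).
apply: lebesgue_measure_unique => _ [[a b] _ <-].
rewrite /= /pushforward (_ : _ @^-1` _ = `](a - s)%R, (b - s)%R]%classic).
  by rewrite !lebesgue_measure_itv/= !lte_fin ltrD2r -!EFinB opprB addrA subrK.
by apply/seteqP; split=> u /=; rewrite !in_itv/= ltrBlDr lerBrDr.
Qed.

Lemma integral_translation (f : time -> \bar R) (s : R) :
  measurable_fun setT f -> (forall x, 0 <= f x) ->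
  \int[lebesgue_measure]_t f t = \int[lebesgue_measure]_u f (u + s)%R.
Proof.
move=> mf f0.
have ms : measurable_fun setT (fun u : time => (u + s)%R : time).
  exact: (measurable_funD (@measurable_id _ time setT) (measurable_cst s)).
have := @ge0_integral_pushforward _ _ time time R _ ms lebesgue_measure setT f.
rewrite preimage_setT => <-//.
by apply: eq_measure_integral => A mA _; exact: lebesgue_translation.
Qed.

Lemma measurable_diff_time : measurable_fun setT (fun z : time * time => (z.1 - z.2)%R : time).
Proof. exact: measurable_funB measurable_fst measurable_snd. Qed.

(** The adjoint of the excitation for Lebesgue measure: future phi s is the
    weight that phi gives to the excitation produced by a point at s. *)
Definition future (phi : time -> \bar R) (s : time) : \bar R :=
  \int[lebesgue_measure]_u (memory u * phi (u + s)%R).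

Section Future.
Variable phi : time -> \bar R.
Hypotheses (mphi : measurable_fun setT phi) (phi0 : forall t, 0 <= phi t).

Let mlag : measurable_fun setT (fun z : time * time => memory (z.1 - z.2)%R).
Proof. exact: measurableT_comp measurable_memory measurable_diff_time. Qed.

Lemma futureE s : future phi s = \int[lebesgue_measure]_t (phi t * memory (t - s)%R).
Proof.
rewrite [RHS](integral_translation _ s).
- by apply: eq_integral => u _; rewrite addrK muleC.
- apply: emeasurable_funM => //; apply: (measurableT_comp measurable_memory).
  exact: (measurable_funB (@measurable_id _ time setT) (measurable_cst s)).
- by move=> t; rewrite mule_ge0// memory_ge0.
Qed.

Lemma future_ge0 s : 0 <= future phi s.
Proof. by apply: integral_ge0 => u _; rewrite mule_ge0// memory_ge0. Qed.

Lemma lebesgue_sigma_finite : sigma_finite setT (@lebesgue_measure R).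
Proof. exact: sigma_finiteT. Qed.

Lemma measurable_future : measurable_fun setT (future phi).
Proof.
apply: (@measurable_integral_param _ _ time time R lebesgue_measure
  (fun s u => memory u * phi (u + s)%R) lebesgue_sigma_finite).
  apply: emeasurable_funM.
    exact: measurableT_comp measurable_memory measurable_snd.
  apply: (measurableT_comp mphi).
  exact: measurable_funD measurable_snd measurable_fst.
by move=> s u; rewrite mule_ge0// memory_ge0.
Qed.

(** The averaging is over translates of phi, with weights of total mass one. *)
Lemma integral_future : \int[lebesgue_measure]_s future phi s = \int[lebesgue_measure]_t phi t.
Proof.
rewrite (@tonelli _ _ time time R lebesgue_measure lebesgue_measure
  (fun s u => memory u * phi (u + s)%R) lebesgue_sigma_finite lebesgue_sigma_finite).
- transitivity (\int[lebesgue_measure]_u (memory u * \int[lebesgue_measure]_t phi t)).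
    apply: eq_integral => u _.
    have mphiu : measurable_fun setT (fun s : time => phi (u + s)%R).
      apply: (measurableT_comp mphi).
      exact: (measurable_funD (measurable_cst u) (@measurable_id _ time setT)).
    rewrite ge0_integralZl//; last exact: memory_ge0.
    rewrite (integral_translation phi u mphi phi0); congr (_ * _).
    by apply: eq_integral => s _; rewrite addrC.
  rewrite ge0_integralZr ?integral_memory ?mul1e//.
  + exact: measurable_memory.
  + by move=> u _; exact: memory_ge0.
  + exact: integral_ge0.
- apply: emeasurable_funM.
    exact: measurableT_comp measurable_memory measurable_snd.
  apply: (measurableT_comp mphi).
  exact: measurable_funD measurable_snd measurable_fst.
- by move=> s u; rewrite mule_ge0// memory_ge0.
Qed.

Lemma future_le (s : time) (c : \bar R) : 0 <= c ->
  (forall t, (s < t)%R -> phi t <= c) -> future phi s <= c.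
Proof.
move=> c0 phic; rewrite -[leRHS]mul1e -integral_memory -ge0_integralZr//; last 2 first.
- exact: measurable_memory.
- by move=> u _; exact: memory_ge0.
apply: ge0_le_integral => //.
- by move=> u _; rewrite mule_ge0// memory_ge0.
- apply: emeasurable_funM; first exact: measurable_memory.
  apply: (measurableT_comp mphi).
  exact: (measurable_funD (@measurable_id _ time setT) (measurable_cst s)).
- by apply: emeasurable_funM; [exact: measurable_memory|exact: measurable_cst].
- move=> u _; have [u0|u0] := leP u 0%R.
    by rewrite /memory patchE mem_setE in_itv/= andbT ltNge u0/= !mul0e.
  by rewrite lee_wpmul2l ?memory_ge0// phic// ltrDr.
Qed.

(** An inequality, because a test function may charge the times before s0. *)
Lemma integral_excitation w :
  \int[m0]_t (phi t * (excitation t w)%:E) <= \int[N w]_s future phi s.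
Proof.
have sfN := point_process_sigma_finite pointN w.
have mlagT : measurable_fun setT (fun z : time * time => phi z.1 * memory (z.1 - z.2)%R).
  by apply: emeasurable_funM => //; exact: measurableT_comp mphi measurable_fst.
have lag0 (t s : time) : 0 <= phi t * memory (t - s)%R by rewrite mule_ge0// memory_ge0.
have lagN t : \int[N w]_s (phi t * memory (t - s)%R) = phi t * (excitation t w)%:E.
  rewrite excitationE ge0_integralZl//.
  - exact: measurable_memory_lag.
  - by move=> s _; exact: memory_ge0.
have mlag0 (s : R) : measurable_fun setT (fun t : time => phi t * memory (t - s)%R).
  apply: emeasurable_funM => //; apply: (measurableT_comp measurable_memory).
  exact: (measurable_funB (@measurable_id _ time setT) (measurable_cst s)).
rewrite (eq_integral (fun t => \int[N w]_s (phi t * memory (t - s)%R))); last first.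
  by move=> t _; rewrite lagN.
rewrite (@tonelli _ _ time time R m0 (N w) (fun t s => phi t * memory (t - s)%R)
  (lebesgue_after_sigma_finite s0) sfN mlagT lag0).
apply: ge0_le_integral => //.
- by move=> s _; exact: integral_ge0.
- apply: (@measurable_integral_param _ _ time time R m0
    (fun s t => phi t * memory (t - s)%R) (lebesgue_after_sigma_finite s0)).
    apply: emeasurable_funM; first exact: measurableT_comp mphi measurable_snd.
    apply: (measurableT_comp measurable_memory).
    exact: measurable_funB measurable_snd measurable_fst.
  by move=> s t; exact: lag0.
- exact: measurable_future.
- move=> s _; rewrite futureE integral_lebesgue_after//.
  by apply: ge0_subset_integral => //; exact: measurable_itv.
Qed.

End Future.
End Excitation.

(** Monotone convergence in the form suited to truncations, which reach their
    limit at every point after finitely many steps. *)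
Lemma ge0_integral_stationary_le {d} {T : measurableType d} {R : realType}
    (mu : {measure set T -> \bar R}) (f_ : nat -> T -> \bar R) (f : T -> \bar R) (k : \bar R) :
  (forall n, measurable_fun setT (f_ n)) -> (forall n x, 0 <= f_ n x)%E ->
  (forall x, {homo f_^~ x : m n / (m <= n)%N >-> (m <= n)%E}) ->
  (forall n x, f_ n x <= f x)%E -> (forall x, exists n, f_ n x = f x) ->
  (forall n, \int[mu]_x f_ n x <= k)%E -> (\int[mu]_x f x <= k)%E.
Proof.
move=> mf f0 ndf fle feq fk.
have fcvg x : f_^~ x @ \oo --> f x.
  apply: cvg_near_cst; have [n fn] := feq x; exists n => // m /= nm.
  by apply/eqP; rewrite eq_le fle -fn ndf.
rewrite (eq_integral (fun x => limn (f_^~ x))); last by move=> x _; exact/esym/cvg_lim.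
have := @cvg_monotone_convergence _ _ _ mu setT measurableT f_ mf (fun n x _ => f0 n x)
  (fun x _ => ndf x).
by move=> cvgI; apply: (cvge_le _ cvgI); exact: nearW.
Qed.

(** * Moments of the counts *)

Section HawkesMoments.
Local Open Scope ereal_scope.
Context {d : measure_display} {Omega : measurableType d} {R : realType}
  {P : probability Omega R} {N : R.-ker Omega ~> (measurableTypeR R)}
  {g : R -> R} {s0 mu rho : R}.
Local Notation time := (measurableTypeR R).
Local Notation m0 := (lebesgue_after s0).
Local Notation lambda := (hawkes_lambda N g s0 mu rho).
Hypotheses (mu_gt0 : (0 < mu)%R) (rho_gt0 : (0 < rho)%R) (rho_lt1 : (rho < 1)%R).
Hypothesis shape_g : kernel_shape g.
Hypothesis hawkesN : linear_hawkes P N g s0 mu rho.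

Let pointN : simple_point_process N s0. Proof. by case: hawkesN. Qed.
Let intensityN : stochastic_intensity P N s0 lambda. Proof. by case: hawkesN. Qed.
Let pl : predictable N (fun x => (lambda x.1 x.2)%:E).
Proof. by case: intensityN. Qed.

Lemma hawkes_lambda_ge t w : (mu <= lambda t w)%R.
Proof.
by rewrite /hawkes_lambda lerDl mulr_ge0 ?(ltW rho_gt0)// (excitation_ge0 shape_g pointN).
Qed.

Lemma measurable_hawkes_lambda w : measurable_fun setT (fun t : time => lambda t w).
Proof. by apply/measurable_EFinP; exact: (measurable_pathwise w pl). Qed.

Lemma measurable_excitation w :
  measurable_fun setT (fun t : time => @excitation _ _ _ N g s0 t w).
Proof.
rewrite (_ : (fun t => _) = (fun t => rho^-1 * (lambda t w - mu))%R).
  apply: measurable_funM => //; apply: measurable_funB => //.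
  exact: measurable_hawkes_lambda.
by apply/funext => t; rewrite /hawkes_lambda addrC addKr mulKf// gt_eqF.
Qed.

Lemma hawkes_intensity_le w (phi : time -> \bar R) :
  measurable_fun setT phi -> (forall t, 0 <= phi t) ->
  \int[m0]_t (phi t * (lambda t w)%:E) <=
  mu%:E * \int[m0]_t phi t + rho%:E * \int[N w]_s future (g := g) phi s.
Proof.
move=> mphi phi0.
have exc0 t : 0 <= phi t * (@excitation _ _ _ N g s0 t w)%:E.
  by rewrite mule_ge0// lee_fin (excitation_ge0 shape_g pointN).
have mexc : measurable_fun setT (fun t : time => phi t * (@excitation _ _ _ N g s0 t w)%:E).
  by apply: emeasurable_funM => //; apply/measurable_EFinP; exact: measurable_excitation.
rewrite (eq_integral (fun t => mu%:E * phi t +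
    rho%:E * (phi t * (@excitation _ _ _ N g s0 t w)%:E))); last first.
  move=> t _; rewrite /hawkes_lambda EFinD EFinM ge0_muleDr.
  - by rewrite muleC muleCA.
  - by rewrite lee_fin ltW.
  - by rewrite -EFinM lee_fin mulr_ge0 ?(ltW rho_gt0)// (excitation_ge0 shape_g pointN).
have mu0 : 0 <= mu%:E by rewrite lee_fin ltW.
have rho0 : 0 <= rho%:E by rewrite lee_fin ltW.
rewrite (@ge0_integralDT _ _ _ m0 (fun t => mu%:E * phi t)
    (fun t => rho%:E * (phi t * (@excitation _ _ _ N g s0 t w)%:E))).
- rewrite ge0_integralZl// ge0_integralZl// leeD2l// lee_wpmul2l//.
  exact: (integral_excitation shape_g pointN).
- exact: emeasurable_funM.
- by move=> t; rewrite mule_ge0.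
- exact: emeasurable_funM.
- by move=> t; rewrite mule_ge0.
Qed.

Section Truncation.
Variable T : R.

(** The process stopped after its n-th point and at time T.  Counting the strict
    past makes this set predictable; it holds boundedly many points, so all
    truncated moments are finite a priori. *)
Definition truncation (n : nat) : set (R * Omega) :=
  [set x | (x.1 <= T)%R /\ N x.2 `]-oo, x.1[%classic < n%:R%:E].

Let C n x : \bar R := (\1_(truncation n) x)%:E.
Let U n w := \int[N w]_t C n (t, w).
Let B n w := \int[m0]_t (C n (t, w) * (lambda t w)%:E).
Let U_ w := N w `]-oo, T]%classic.
Let c := fine (m0 `]-oo, T]%classic).

Let c0 : (0 <= c)%R. Proof. exact: fine_ge0. Qed.

Let m0T : m0 `]-oo, T]%classic = c%:E.
Proof. by rewrite fineK// ge0_fin_numE// lebesgue_after_lty. Qed.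

Lemma measurable_truncation n :
  measurable (truncation n : set (g_sigma_algebraType (predictable_rectangles N))).
Proof.
have past : predictable N (fun x => N x.2 `]-oo, x.1[%classic).
  have := @predictable_measure_past _ _ _ N N (adapted_point_process (N := N))
    (point_process_past_lty pointN) setT measurableT.
  by rewrite (_ : (fun x => _) = fun x => N x.2 `]-oo, x.1[%classic)//;
    apply/funext => x; congr (N x.2 _); apply/seteqP; split=> s //= [].
rewrite (_ : truncation n = (fst @^-1` `]-oo, T]%classic) `&`
    ((fun x => N x.2 `]-oo, x.1[%classic) @^-1` `]-oo, n%:R%:E[%classic)).
  apply: measurableI.
  - by rewrite -[X in measurable X]setTI; apply: (measurable_time N).
  - rewrite -[X in measurable X]setTI; apply: past => //.
    exact: emeasurable_itv.
by apply/seteqP; split=> x /=; rewrite !in_itv.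
Qed.

Let pC n : predictable N (C n).
Proof.
by apply/measurable_EFinP; apply: measurable_indic; exact: measurable_truncation.
Qed.

Let C0 n x : 0 <= C n x. Proof. by rewrite lee_fin. Qed.

Let A n w : set time := [set t | truncation n (t, w)].

Let mA n w : measurable (A n w).
Proof.
rewrite -[X in measurable X]setTI.
by have := measurable_pair_time N w; apply => //; exact: measurable_truncation.
Qed.

Let AT n w : A n w `<=` `]-oo, T].
Proof. by move=> t [/= tT _]; rewrite in_itv. Qed.

Let CE n w t : C n (t, w) = (\1_(A n w) t)%:E.
Proof. by rewrite /C !indicE; congr (_%:R%:E); apply/idP/idP => /set_mem ?; exact/mem_set. Qed.

Let UE n w : U n w = N w (A n w).
Proof. by rewrite /U; under eq_integral do rewrite CE; rewrite integral_indic// setIT. Qed.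

Let U_lt n w : U n w <= n.+1%:R%:E.
Proof.
have [X [_ finX NE]] := pointN w; rewrite UE.
apply: (point_measure_capped finX NE _ T) => //.
by move=> t [_ /=]; exact: ltW.
Qed.

Let U0 n w : 0 <= U n w. Proof. by rewrite UE. Qed.

Let B0 n w : 0 <= B n w.
Proof.
by apply: integral_ge0 => t _; rewrite mule_ge0// lee_fin (le_trans (ltW mu_gt0))// hawkes_lambda_ge.
Qed.

(** A time outside the truncated window has no later time inside it, hence the
    future average of the indicator is at most the indicator: the truncation is
    compatible with the feedback of the process on its intensity. *)
Let BU n w : B n w <= (mu * c)%:E + rho%:E * U n w.
Proof.
have mC : measurable_fun setT (fun t : time => C n (t, w)).
  exact: (measurable_pathwise w (pC n)).
apply: (le_trans (hawkes_intensity_le w _ mC (fun t => C0 n (t, w)))).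
have mu0 : 0 <= mu%:E by rewrite lee_fin ltW.
have rho0 : 0 <= rho%:E by rewrite lee_fin ltW.
rewrite EFinM leeD//; [apply: (lee_wpmul2l mu0)|apply: (lee_wpmul2l rho0)].
  rewrite (eq_integral (fun t => (\1_(A n w) t)%:E)); last by move=> t _; rewrite CE.
  by rewrite integral_indic// setIT -m0T le_measure// inE.
apply: ge0_le_integral => //.
- by move=> s _; exact: future_ge0.
- exact: measurable_future.
- move=> s _; apply: future_le => // t st.
  rewrite !CE !indicE lee_fin ler_nat; case: (boolP (t \in A n w)) => // /set_mem[/= tT Nt].
  rewrite mem_set//; split=> /=; first exact: le_trans (ltW st) tT.
  apply: le_lt_trans Nt; apply: le_measure; rewrite ?inE//.
  by move=> r /=; rewrite !in_itv/= => /lt_trans; exact.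
Qed.

Let mU n : measurable_fun setT (U n).
Proof. exact: (measurable_integral_N pointN _ (pC n) (C0 n)). Qed.

Let mB n : measurable_fun setT (B n).
Proof.
have pB : predictable N (fun x => C n x * (lambda x.1 x.2)%:E).
  exact: emeasurable_funM (pC n) pl.
apply: (measurable_integral_m0 _ pB) => x.
by rewrite mule_ge0// lee_fin (le_trans (ltW mu_gt0))// hawkes_lambda_ge.
Qed.

Let U_fin n w : U n w \is a fin_num.
Proof. by rewrite ge0_fin_numE//; exact: le_lt_trans (U_lt n w) (ltry _). Qed.

Let B_fin n w : B n w \is a fin_num.
Proof.
rewrite ge0_fin_numE//; apply: le_lt_trans (BU n w) _.
by rewrite -(fineK (U_fin n w)) -EFinM -EFinD ltry.
Qed.

Let EUB n : \int[P]_w U n w = \int[P]_w B n w.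
Proof. exact: (expectation_intensity pointN intensityN _ (pC n) (C0 n)). Qed.

(** E U = E B <= mu c + rho E U, which can be solved since E U is finite. *)
Let EU_le n : \int[P]_w U n w <= (mu * c / (1 - rho))%:E.
Proof.
have EU0 : 0 <= \int[P]_w U n w by exact: integral_ge0.
have rho0 : 0 <= rho%:E by rewrite lee_fin ltW.
have EUfin : \int[P]_w U n w \is a fin_num.
  rewrite ge0_fin_numE//; apply: (@le_lt_trans _ _ (\int[P]_w (cst n.+1%:R%:E w))).
    by apply: ge0_le_integral => // w _; exact: U_lt.
  by rewrite integral_cst//= probability_setT mule1 ltry.
have : \int[P]_w U n w <= (mu * c)%:E + rho%:E * \int[P]_w U n w.
  rewrite {1}EUB; apply: (@le_trans _ _ (\int[P]_w ((mu * c)%:E + rho%:E * U n w))).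
    apply: ge0_le_integral => //.
    - by apply: emeasurable_funD => //; exact: emeasurable_funM.
  rewrite (@ge0_integralDT _ _ _ P (cst (mu * c)%:E) (fun w => rho%:E * U n w))//.
  - by rewrite integral_cst//= probability_setT mule1 ge0_integralZl.
  - by move=> w; rewrite lee_fin mulr_ge0// ltW.
  - exact: emeasurable_funM.
  - by move=> w; exact: mule_ge0.
rewrite -(fineK EUfin) -EFinM -EFinD !lee_fin => Ule.
rewrite ler_pdivlMr ?subr_gt0//; move: Ule; set f := fine _; lra.
Qed.

(** The constant given by (x + y)^2 <= 2 (x^2 + y^2) for x = mu c and
    y = U - B, whose second moment is E U by the isometry. *)
Let k : R := (2 / (1 - rho) ^+ 2 * ((mu * c) ^+ 2 + mu * c / (1 - rho)))%R.

(** From B <= mu c + rho U follows (1 - rho) U <= mu c + (U - B). *)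
Let EU2_le n : \int[P]_w (U n w * U n w) <= k%:E.
Proof.
pose u w := fine (U n w); pose b w := fine (B n w).
have Uu w : U n w = (u w)%:E by rewrite fineK.
have Bb w : B n w = (b w)%:E by rewrite fineK.
have u0 w : (0 <= u w)%R by exact: fine_ge0.
have b0 w : (0 <= b w)%R by exact: fine_ge0.
have ule w : (u w <= n.+1%:R)%R by rewrite -lee_fin -Uu.
have bu w : (b w <= mu * c + rho * u w)%R by have := BU n w; rewrite Uu Bb -EFinM -EFinD lee_fin.
have mc0 : (0 <= mu * c)%R by rewrite mulr_ge0// ltW.
have ble w : (b w <= mu * c + rho * n.+1%:R)%R.
  by apply: le_trans (bu w) _; rewrite lerD2l ler_wpM2l// ltW.
have mu_ : measurable_fun setT u.
  by apply: (measurableT_comp _ (mU n)) => //.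
have mb : measurable_fun setT b.
  by apply: (measurableT_comp _ (mB n)) => //.
have bounded2 (f : Omega -> R) (M : R) : measurable_fun setT f -> (forall w, 0 <= f w <= M)%R ->
    \int[P]_w (f w ^+ 2)%:E < +oo.
  move=> mf fM; apply: (@le_lt_trans _ _ (\int[P]_w (cst (M ^+ 2)%:E w))).
    apply: ge0_le_integral => //.
    - by move=> w _; rewrite lee_fin sqr_ge0.
    - by apply/measurable_EFinP; exact: measurable_funX.
    - move=> w _; rewrite lee_fin; have /andP[f0 fm] := fM w.
      by rewrite ler_pXn2r ?nnegrE ?(le_trans f0).
  by rewrite integral_cst//= probability_setT mule1 ltry.
have [_ _ X2 _] := variance_compensated pointN intensityN (C n) (pC n) (C0 n) u b Uu Bb
  (bounded2 _ _ mu_ (fun w => introT andP (conj (u0 w) (ule w))))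
  (bounded2 _ _ mb (fun w => introT andP (conj (b0 w) (ble w)))).
have {}X2 : \int[P]_w ((u w - b w) ^+ 2)%:E <= (mu * c / (1 - rho))%:E.
  rewrite X2 (eq_integral (B n)) -?EUB// => w _; apply: eq_integral => t _.
  rewrite muleA CE indicE; case: (t \in A n w); by rewrite ?mul1e// !mul0e.
have rho1 : (0 < 1 - rho)%R by rewrite subr_gt0.
pose q : R := (2 / (1 - rho) ^+ 2)%R.
have q0 : (0 <= q)%R by rewrite divr_ge0// sqr_ge0.
have mX : measurable_fun setT (fun w => ((u w - b w) ^+ 2)%:E).
  by apply/measurable_EFinP; apply: measurable_funX; exact: measurable_funB.
have X0 w : 0 <= ((u w - b w) ^+ 2)%:E by rewrite lee_fin sqr_ge0.
have uX w : U n w * U n w <= q%:E * (((mu * c) ^+ 2)%:E + ((u w - b w) ^+ 2)%:E).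
  rewrite Uu -EFinM -EFinD -EFinM lee_fin /q mulrAC ler_pdivlMr ?exprn_gt0//.
  have := bu w; have := u0 w; move: (u w) (b w) => x y x0 yx.
  have h : (0 <= (1 - rho) * x <= mu * c + (x - y))%R.
    by rewrite mulr_ge0 ?(ltW rho1)//=; lra.
  have h2 : (((1 - rho) * x) ^+ 2 <= (mu * c + (x - y)) ^+ 2)%R.
    by case/andP: h => h1 h2; rewrite ler_pXn2r ?nnegrE// (le_trans h1).
  have h3 : (0 <= (mu * c - (x - y)) ^+ 2)%R by exact: sqr_ge0.
  by move: h2 h3; rewrite !expr2; lra.
apply: (@le_trans _ _ (\int[P]_w (q%:E * (((mu * c) ^+ 2)%:E + ((u w - b w) ^+ 2)%:E)))).
  apply: ge0_le_integral => //.
  - by move=> w _; rewrite mule_ge0.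
  - exact: emeasurable_funM.
  - by apply: emeasurable_funM => //; exact: emeasurable_funD.
rewrite ge0_integralZl//; last 2 first.
- exact: emeasurable_funD.
- by move=> w _; rewrite adde_ge0// lee_fin sqr_ge0.
rewrite (@ge0_integralDT _ _ _ P (cst ((mu * c) ^+ 2)%:E))//; last first.
  by move=> w; rewrite lee_fin sqr_ge0.
rewrite integral_cst//= probability_setT mule1.
rewrite (_ : k%:E = q%:E * (((mu * c) ^+ 2)%:E + (mu * c / (1 - rho))%:E))//.
by apply: lee_wpmul2l; [rewrite lee_fin|rewrite leeD2l].
Qed.

Let U_ge n w : U n w <= U_ w.
Proof. by rewrite UE le_measure// inE. Qed.

Let U_mono w : {homo U^~ w : m n / (m <= n)%N >-> m <= n}.
Proof.
move=> m n mn; rewrite !UE; apply: le_measure; rewrite ?inE//.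
move=> t [/= tT Nt]; split => //=; apply: (lt_le_trans Nt).
by rewrite lee_fin ler_nat.
Qed.

Let U_eventually w : exists n, U n w = U_ w.
Proof.
have NT : N w `]-oo, T[%classic \is a fin_num.
  by rewrite ge0_fin_numE//; exact: point_process_past_lty.
exists (Num.truncn (fine (N w `]-oo, T[%classic))).+1.
rewrite UE /U_; congr (N w _); apply/seteqP; split=> [|t]; first exact: AT.
rewrite /= in_itv/= => tT; split=> //=.
apply: (@le_lt_trans _ _ (N w `]-oo, T[%classic)).
  apply: le_measure; rewrite ?inE//.
  by move=> s /=; rewrite !in_itv/= => /lt_le_trans; apply.
by rewrite -[ltLHS](fineK NT) lte_fin Num.Theory.truncnS_gt.
Qed.

Lemma expected_count_le :
  \int[P]_w N w `]-oo, T]%classic <= (mu * fine (m0 `]-oo, T]%classic) / (1 - rho))%:E.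
Proof.
exact: (@ge0_integral_stationary_le _ _ _ P U U_ _ mU U0 U_mono U_ge U_eventually EU_le).
Qed.

Lemma expected_square_count_lty :
  \int[P]_w (N w `]-oo, T]%classic * N w `]-oo, T]%classic) < +oo.
Proof.
apply: le_lt_trans (ltry k).
apply: (@ge0_integral_stationary_le _ _ _ P (fun n w => U n w * U n w)).
- by move=> n; exact: emeasurable_funM.
- by move=> n w; rewrite mule_ge0.
- by move=> w m n mn; apply: lee_pmul => //; exact: U_mono.
- by move=> n w; apply: lee_pmul => //; exact: U_ge.
- by move=> w; have [n Un] := U_eventually w; exists n; rewrite Un.
- exact: EU2_le.
Qed.

End Truncation.

(** * The process stays below its stationary rate *)

Section StationaryBound.
Variables (T L : R).
Hypothesis L0 : (0 <= L)%R.

Let past_T (t : time) : \bar R := (\1_(`]-oo, T]%classic : set time) t)%:E.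

Let window : set (time -> \bar R) :=
  [set phi | [/\ measurable_fun setT phi, forall t, 0 <= phi t,
    forall t, phi t <= past_T t & \int[lebesgue_measure]_t phi t <= L%:E]].

Let expected phi := \int[P]_w \int[N w]_t phi t.

(** Averaging over the future preserves the integral, and the indicator of a
    past half-line bounds its own future averages. *)
Let window_future phi : window phi -> window (future (g := g) phi).
Proof.
move=> [mphi phi0 phiT phiL]; split.
- exact: measurable_future.
- by move=> s; exact: future_ge0.
- move=> s; rewrite /past_T indicE mem_setE in_itv/=; have [sT|Ts] := leP s T.
    apply: future_le => // t _; apply: (le_trans (phiT t)).
    by rewrite /past_T lee_fin indicE lern1 leq_b1.
  apply: future_le => // t st; apply: (le_trans (phiT t)).
  have tT : (t <= T)%R = false by rewrite leNgt (lt_trans Ts st).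
  by rewrite /past_T indicE mem_setE in_itv/= tT.
- by rewrite (integral_future shape_g).
Qed.

Let predictable_det (phi : time -> \bar R) : measurable_fun setT phi ->
  predictable N (fun x => phi x.1).
Proof. exact: predictable_time. Qed.

Let measurable_det (phi : time -> \bar R) : measurable_fun setT phi -> (forall t, 0 <= phi t) ->
  measurable_fun setT (fun w => \int[N w]_t phi t).
Proof.
move=> mphi phi0.
exact: (measurable_integral_N pointN (fun x => phi x.1) (predictable_det _ mphi)
  (fun x => phi0 x.1)).
Qed.

Let expected_step phi : window phi ->
  expected phi <= (mu * L)%:E + rho%:E * expected (future (g := g) phi).
Proof.
move=> wphi; have [mphi phi0 phiT phiL] := wphi.
have [mf f0 _ _] := window_future _ wphi.
have mu0 : 0 <= mu%:E by rewrite lee_fin ltW.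
have rho0 : 0 <= rho%:E by rewrite lee_fin ltW.
have muL0 : 0 <= (mu * L)%:E by rewrite lee_fin mulr_ge0// ltW.
have mN := measurable_det _ mf f0.
have N0 w : 0 <= \int[N w]_s future (g := g) phi s by exact: integral_ge0.
rewrite /expected (expectation_intensity pointN intensityN _ (predictable_det _ mphi)
  (fun x => phi0 x.1)).
apply: (@le_trans _ _ (\int[P]_w ((mu * L)%:E +
    rho%:E * \int[N w]_s future (g := g) phi s))).
  apply: ge0_le_integral => //.
  - by move=> w _; apply: integral_ge0 => t _;
      rewrite mule_ge0// lee_fin (le_trans (ltW mu_gt0))// hawkes_lambda_ge.
  - apply: (measurable_integral_m0 (fun x => phi x.1 * (lambda x.1 x.2)%:E)).
      exact: emeasurable_funM (predictable_det _ mphi) pl.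
    by move=> x; rewrite mule_ge0// lee_fin (le_trans (ltW mu_gt0))// hawkes_lambda_ge.
  - by apply: emeasurable_funD => //; exact: emeasurable_funM.
  - move=> w _; apply: (le_trans (hawkes_intensity_le w _ mphi phi0)).
    rewrite leeD2r// EFinM; apply: lee_wpmul2l => //; apply: le_trans phiL.
    rewrite integral_lebesgue_after//.
    by apply: ge0_subset_integral => //; exact: measurable_itv.
rewrite (@ge0_integralDT _ _ _ P (cst (mu * L)%:E)
  (fun w => rho%:E * \int[N w]_s future (g := g) phi s))//.
- by rewrite integral_cst//= probability_setT mule1 ge0_integralZl.
- exact: emeasurable_funM.
- by move=> w; exact: mule_ge0.
Qed.

(** The bound depends on the integral of phi only and not on the age T - s0 of
    the process.  The supremum S of the expectations over the stable class of
    test functions satisfies S <= mu L + rho S; the cruder bound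
    [expected_count_le], which does depend on the age, ensures that S is
    finite. *)
Lemma expected_integral_le phi : measurable_fun setT phi -> (forall t, 0 <= phi t) ->
  (forall t, phi t <= (\1_(`]-oo, T]%classic : set time) t)%:E) ->
  \int[lebesgue_measure]_t phi t <= L%:E ->
  \int[P]_w \int[N w]_t phi t <= (mu * L / (1 - rho))%:E.
Proof.
move=> mphi phi0 phiT phiL.
have wphi : window phi by [].
pose S := ereal_sup [set expected f | f in window].
have SE f : window f -> expected f <= S by move=> wf; apply: ereal_sup_ubound; exists f.
have S0 : 0 <= S.
  apply: le_trans (SE _ wphi); apply: integral_ge0 => w _; exact: integral_ge0.
have Sfin : S \is a fin_num.
  rewrite ge0_fin_numE//.
  apply: (@le_lt_trans _ _ (mu * fine (m0 `]-oo, T]%classic) / (1 - rho))%:E); last exact: ltry.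
  apply: ub_ereal_sup => _ [f [mf f0 fT _] <-].
  apply: le_trans (expected_count_le T); apply: ge0_le_integral => //.
  - by move=> w _; exact: integral_ge0.
  - exact: measurable_det.
  - exact: measurable_kernel.
  - move=> w _; have mT : measurable (`]-oo, T]%classic : set time) by exact: measurable_itv.
    have <- := integral_indicT (N w) mT.
    by apply: ge0_le_integral => //; apply/measurable_EFinP; exact: measurable_indic.
have rho0 : 0 <= rho%:E by rewrite lee_fin ltW.
have : S <= (mu * L)%:E + rho%:E * S.
  apply: ub_ereal_sup => _ [f wf <-]; apply: (le_trans (expected_step _ wf)).
  by rewrite leeD2l//; apply: lee_wpmul2l => //; apply: SE; exact: window_future.
move=> Sle; apply: (le_trans (SE _ wphi)); move: Sle.
rewrite -(fineK Sfin) -EFinM -EFinD !lee_fin => Sle.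
by rewrite ler_pdivlMr ?subr_gt0//; move: Sle; set f := fine _; lra.
Qed.

End StationaryBound.

(** * Compensated integrals of bounded integrands *)

Section BoundedIntegrand.
Variables (T : R) (H : R * Omega -> \bar R).
Hypotheses (pH : predictable N H) (H0 : forall x, 0 <= H x).
Hypothesis HT : forall t w, H (t, w) <= (\1_(`]-oo, T]%classic : set time) t)%:E.

Let U w := \int[N w]_t H (t, w).
Let B w := \int[m0]_t (H (t, w) * (lambda t w)%:E).
Let n w := fine (N w `]-oo, T]%classic).
Let c := fine (m0 `]-oo, T]%classic).

Let mT : measurable (`]-oo, T]%classic : set time). Proof. exact: measurable_itv. Qed.

Let NT w : N w `]-oo, T]%classic = (n w)%:E.
Proof.
have [X [_ finX NE]] := pointN w.
by rewrite fineK// ge0_fin_numE//; exact: (point_measure_lty finX NE).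
Qed.

Let m0T : m0 `]-oo, T]%classic = c%:E.
Proof. by rewrite fineK// ge0_fin_numE// lebesgue_after_lty. Qed.

Let c0 : (0 <= c)%R. Proof. exact: fine_ge0. Qed.

Let mind : measurable_fun setT (fun t : time => (\1_(`]-oo, T]%classic : set time) t)%:E : \bar R).
Proof. by apply/measurable_EFinP; exact: measurable_indic. Qed.

Let mH w : measurable_fun setT (fun t : time => H (t, w)).
Proof. exact: (measurable_pathwise w pH). Qed.

Let l0 t w : 0 <= (lambda t w)%:E.
Proof. by rewrite lee_fin (le_trans (ltW mu_gt0))// hawkes_lambda_ge. Qed.

Let ml w : measurable_fun setT (fun t : time => (lambda t w)%:E).
Proof. exact: (measurable_pathwise w pl). Qed.

Let U_le w : U w <= (n w)%:E.
Proof.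
rewrite -NT -(integral_indicT (N w) mT).
by apply: ge0_le_integral => // t _; exact: HT.
Qed.

Let B_le w : B w <= (mu * c + rho * n w)%:E.
Proof.
apply: (@le_trans _ _
  (\int[m0]_t ((\1_(`]-oo, T]%classic : set time) t)%:E * (lambda t w)%:E))).
  apply: ge0_le_integral => //.
  - by move=> t _; exact: mule_ge0.
  - exact: emeasurable_funM.
  - exact: emeasurable_funM.
  - by move=> t _; apply: lee_wpmul2r => //; exact: HT.
apply: (le_trans (hawkes_intensity_le w _ mind _)); first by move=> t; rewrite lee_fin.
rewrite EFinD !EFinM; apply: leeD.
  by apply: lee_wpmul2l; rewrite ?lee_fin ?(ltW mu_gt0)// integral_indic// setIT m0T.
apply: lee_wpmul2l; first by rewrite lee_fin ltW.
rewrite -NT -(integral_indicT (N w) mT).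
apply: ge0_le_integral => //.
- by move=> s _; apply: future_ge0 => // t; rewrite lee_fin.
- by apply: measurable_future => // t; rewrite lee_fin.
- move=> s _; apply: future_le => //; rewrite ?lee_fin// => t st.
  by rewrite lee_fin !indicE !mem_setE !in_itv/= ler_nat; have [/(le_trans (ltW st))->|] := leP t T.
Qed.

Let U0 w : 0 <= U w. Proof. exact: integral_ge0. Qed.
Let B0 w : 0 <= B w. Proof. by apply: integral_ge0 => t _; exact: mule_ge0. Qed.

Lemma integral_N_fin w : U w \is a fin_num.
Proof. by rewrite ge0_fin_numE//; exact: le_lt_trans (U_le w) (ltry _). Qed.

Lemma integral_m0_fin w : B w \is a fin_num.
Proof. by rewrite ge0_fin_numE//; exact: le_lt_trans (B_le w) (ltry _). Qed.

Let square_lty (f : Omega -> R) (a b : R) : measurable_fun setT f -> (0 <= a)%R -> (0 <= b)%R ->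
  (forall w, 0 <= f w <= a + b * n w)%R -> \int[P]_w (f w ^+ 2)%:E < +oo.
Proof.
move=> mf a0 b0 fn.
have mN : measurable_fun setT (fun w => N w `]-oo, T]%classic) by exact: measurable_kernel.
have n2 : \int[P]_w (N w `]-oo, T]%classic * N w `]-oo, T]%classic) < +oo.
  exact: expected_square_count_lty.
apply: (@le_lt_trans _ _ (\int[P]_w ((2 * a ^+ 2)%:E +
    (2 * b ^+ 2)%:E * (N w `]-oo, T]%classic * N w `]-oo, T]%classic)))).
  apply: ge0_le_integral => //.
  - by move=> w _; rewrite lee_fin sqr_ge0.
  - by apply/measurable_EFinP; exact: measurable_funX.
  - by apply: emeasurable_funD => //; apply: emeasurable_funM => //; exact: emeasurable_funM.
  - move=> w _; rewrite NT -!EFinM -EFinD lee_fin; have /andP[f0 fle] := fn w.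
    have : (f w ^+ 2 <= (a + b * n w) ^+ 2)%R by rewrite ler_pXn2r ?nnegrE// (le_trans f0).
    have : (0 <= (a - b * n w) ^+ 2)%R by exact: sqr_ge0.
    rewrite !expr2; lra.
rewrite (@ge0_integralDT _ _ _ P (cst (2 * a ^+ 2)%:E)
  (fun w => (2 * b ^+ 2)%:E * (N w `]-oo, T]%classic * N w `]-oo, T]%classic)))//.
- rewrite integral_cst//= probability_setT mule1 ge0_integralZl//.
  + by rewrite lte_add_pinfty ?ltry// lte_mul_pinfty// lee_fin mulr_ge0// sqr_ge0.
  + exact: emeasurable_funM.
  + by rewrite lee_fin mulr_ge0// sqr_ge0.
- by move=> w; rewrite lee_fin mulr_ge0// sqr_ge0.
- by apply: emeasurable_funM => //; exact: emeasurable_funM.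
- by move=> w; rewrite !mule_ge0// lee_fin mulr_ge0// sqr_ge0.
Qed.

(** For an integrand between 0 and the indicator of (-oo, T] the integral and its
    compensator are dominated by affine functions of the count up to T. *)
Lemma compensated_bounded :
  let u w := fine (U w) in let b w := fine (B w) in
  [/\ b \in Lfun P 2%:E, (u \- b)%R \in Lfun P 2%:E &
      'V_P[(u \- b)%R] = \int[P]_w \int[m0]_t (H (t, w) * (H (t, w) * (lambda t w)%:E))].
Proof.
move=> u b.
have Uu w : U w = (u w)%:E by rewrite fineK// integral_N_fin.
have Bb w : B w = (b w)%:E by rewrite fineK// integral_m0_fin.
have mU : measurable_fun setT u.
  apply: (measurableT_comp _ (measurable_integral_N pointN _ pH H0)) => //.
have mB : measurable_fun setT b.
  have pB : predictable N (fun x => H x * (lambda x.1 x.2)%:E) by exact: emeasurable_funM pH pl.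
  have B0' x : 0 <= H x * (lambda x.1 x.2)%:E by exact: mule_ge0.
  apply: (measurableT_comp _ (measurable_integral_m0 _ pB B0')) => //.
have [||? ? _ ?] := variance_compensated pointN intensityN H pH H0 u b Uu Bb; last by split.
- apply: (square_lty u 0 1) => // w.
  by rewrite mul1r add0r -!lee_fin -Uu U0 U_le.
- apply: (square_lty b (mu * c) rho) => //; [by rewrite mulr_ge0// ltW|exact: ltW|].
  by move=> w; rewrite -!lee_fin -Bb B0 B_le.
Qed.

End BoundedIntegrand.

(** * The score *)

Section Window.
Variable T : R.
Hypotheses (T_gt0 : (0 < T)%R) (s0_le0 : (s0 <= 0)%R).

Let D : set time := `]0%R, T].
Let mD : measurable D. Proof. exact: measurable_itv. Qed.

Lemma integral_window (f : time -> \bar R) : measurable_fun setT f -> (forall t, 0 <= f t) ->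
  \int[lebesgue_measure]_(t in `[0%R, T]) f t = \int[m0]_t ((\1_D t)%:E * f t).
Proof.
move=> mf f0.
have mDf : measurable_fun setT (fun t : time => (\1_D t)%:E * f t).
  by apply: emeasurable_funM => //; apply/measurable_EFinP; exact: measurable_indic.
rewrite integral_lebesgue_after//; last by move=> t; rewrite mule_ge0// lee_fin.
rewrite -integral_itv_obnd_cbnd; last exact: measurable_funTS.
rewrite [LHS]integral_mkcond [RHS]integral_mkcond; apply: eq_integral => t _.
rewrite !patchE indicE; case: ifPn => [/set_mem tD|/negP tD].
  rewrite mem_set ?mem_set ?mul1e//.
  by move: tD; rewrite /D/= !in_itv/= andbT => /andP[/(le_lt_trans s0_le0)].
by rewrite mul0e if_same.
Qed.

Lemma lebesgue_after_window : m0 D = T%:E.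
Proof.
rewrite /lebesgue_after/= /mrestr (_ : _ `&` _ = D).
  by rewrite lebesgue_measure_itv/= lte_fin T_gt0 sube0.
apply/seteqP; split=> [t []//|t Dt]; split=> //; move: Dt.
by rewrite /D/= !in_itv/= andbT => /andP[/(le_lt_trans s0_le0)].
Qed.

Let lambda_gt0 t w : (0 < lambda t w)%R.
Proof. exact: lt_le_trans mu_gt0 (hawkes_lambda_ge t w). Qed.

(** On the window, h1 and h2 are the shares of the baseline and of the excitation
    in the intensity; h1 is the derivative of log lambda in log mu, and
    - (a / rho) h2 is its derivative in log (1 - rho). *)
Let h0 (t : R) (w : Omega) : R := \1_D t.
Let h1 t w : R := (\1_D t * (mu / lambda t w))%R.
Let h2 t w : R := (\1_D t * (1 - mu / lambda t w))%R.

Let frac01 t w : (0 <= mu / lambda t w <= 1)%R.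
Proof.
by rewrite divr_ge0 ?(ltW mu_gt0) ?(ltW (lambda_gt0 t w))//= ler_pdivrMr// mul1r hawkes_lambda_ge.
Qed.

Let ind01 t : (0 <= (\1_D t : R) <= 1)%R.
Proof. by rewrite indicE ler0n lern1 leq_b1. Qed.

Let predE (h : R -> Omega -> R) := fun x : R * Omega => (h x.1 x.2)%:E.

Let pind : predictable N (predE h0).
Proof.
apply: (predictable_time N (fun t : time => (\1_D t)%:E)).
by apply/measurable_EFinP; exact: measurable_indic.
Qed.

Let measurable_pred (h : R -> Omega -> R) : predictable N (predE h) <->
  measurable_fun setT ((fun x => h x.1 x.2) : g_sigma_algebraType (predictable_rectangles N) -> R).
Proof. by split => /measurable_EFinP. Qed.

Let pfrac : measurable_fun setT
  ((fun x => (mu / lambda x.1 x.2)%R) : g_sigma_algebraType (predictable_rectangles N) -> R).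
Proof.
(* lambda is positive, so its inverse is its power of exponent -1. *)
rewrite (_ : (fun x => _) = (fun x => (mu * lambda x.1 x.2 `^ (-1))%R)); last first.
  by apply/funext => x; rewrite powR_inv1// ltW.
apply: measurable_funM => //; apply: (measurableT_comp (measurable_powR (-1)%R)).
exact/measurable_pred.
Qed.

Let ph1 : predictable N (predE h1).
Proof.
by apply/measurable_pred; exact: (measurable_funM ((measurable_pred h0).1 pind) pfrac).
Qed.

Let ph2 : predictable N (predE h2).
Proof.
apply/measurable_pred.
have mfrac : measurable_fun setT ((fun x => (1 - mu / lambda x.1 x.2)%R) :
    g_sigma_algebraType (predictable_rectangles N) -> R).
  by apply: measurable_funB => //; exact: pfrac.
exact: (measurable_funM ((measurable_pred h0).1 pind) mfrac).
Qed.

Let bounds (h : R -> Omega -> R) := forall t w, (0 <= h t w <= \1_D t)%R.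

Let b0 : bounds h0. Proof. by move=> t w; rewrite /h0 lexx andbT; case/andP: (ind01 t). Qed.

Let b1 : bounds h1.
Proof.
move=> t w; have /andP[i0 i1] := ind01 t; have /andP[f0 f1] := frac01 t w.
by rewrite /h1 mulr_ge0//= ler_piMr.
Qed.

Let b2 : bounds h2.
Proof.
move=> t w; have /andP[i0 i1] := ind01 t; have /andP[f0 f1] := frac01 t w.
by rewrite /h2 mulr_ge0 ?subr_ge0//= ler_piMr// gerBl.
Qed.

Let bounds_ge0 h : bounds h -> forall x, 0 <= predE h x.
Proof. by move=> bh x; rewrite lee_fin; case/andP: (bh x.1 x.2). Qed.

Let bounds_T h : bounds h -> forall t w,
  predE h (t, w) <= (\1_(`]-oo, T]%classic : set time) t)%:E.
Proof.
move=> bh t w; rewrite lee_fin/=; case/andP: (bh t w) => _ /le_trans; apply.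
by rewrite !indicE !mem_setE !in_itv/= ler_nat; case: (0 < t)%R.
Qed.

(** X h is the compensated integral of h, and v h will be its variance. *)
Let u h w := fine (\int[N w]_t (h t w)%:E).
Let b h w := fine (\int[m0]_t ((h t w)%:E * (lambda t w)%:E)).
Let X h := (u h \- b h)%R.
Let v h := \int[P]_w \int[m0]_t ((h t w)%:E * ((h t w)%:E * (lambda t w)%:E)).

Let uE h w : predictable N (predE h) -> bounds h -> (u h w)%:E = \int[N w]_t (h t w)%:E.
Proof.
move=> ph bh; rewrite fineK//.
exact: (integral_N_fin T (predE h) ph (bounds_ge0 _ bh) (bounds_T _ bh)).
Qed.

Let bE h w : predictable N (predE h) -> bounds h ->
  (b h w)%:E = \int[m0]_t ((h t w)%:E * (lambda t w)%:E).
Proof.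
move=> ph bh; rewrite fineK//.
exact: (integral_m0_fin T (predE h) ph (bounds_ge0 _ bh) (bounds_T _ bh)).
Qed.

Let moments h : predictable N (predE h) -> bounds h ->
  [/\ b h \in Lfun P 2%:E, X h \in Lfun P 2%:E & 'V_P[X h] = v h].
Proof.
move=> ph bh.
exact: (compensated_bounded T (predE h) ph (bounds_ge0 _ bh) (bounds_T _ bh)).
Qed.

Let v_fin h : predictable N (predE h) -> bounds h -> v h \is a fin_num.
Proof. by move=> ph bh; have [_ LX <-] := moments _ ph bh; exact: variance_fin_num. Qed.

Let ml w : measurable_fun setT (fun t : time => (lambda t w)%:E).
Proof. exact: (measurable_pathwise w pl). Qed.

Let mh h w : predictable N (predE h) -> measurable_fun setT (fun t : time => (h t w)%:E).
Proof. by move=> ph; exact: (measurable_pathwise w ph). Qed.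

Let integrand h t w := (h t w)%:E * ((h t w)%:E * (lambda t w)%:E).

Let integrand_ge0 h t w : bounds h -> 0 <= integrand h t w.
Proof.
move=> bh; have h_ge0 := bounds_ge0 _ bh (t, w).
by rewrite /integrand mule_ge0// mule_ge0// lee_fin ltW.
Qed.

Let mintegrand h w : predictable N (predE h) ->
  measurable_fun setT (fun t : time => integrand h t w).
Proof.
by move=> ph; apply: emeasurable_funM; [|apply: emeasurable_funM]; rewrite ?ml//; exact: mh.
Qed.

Let mpath h : predictable N (predE h) -> bounds h ->
  measurable_fun setT (fun w => \int[m0]_t integrand h t w).
Proof.
move=> ph bh.
apply: (measurable_integral_m0 (fun x => predE h x * (predE h x * (lambda x.1 x.2)%:E))).
  exact: (emeasurable_funM ph (emeasurable_funM ph pl)).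
by move=> x; exact: integrand_ge0.
Qed.

(** Integral over the window of
    lambda + mu^2 / lambda = (lambda - mu)^2 / lambda + 2 mu. *)
Let information_relation : v h0 + v h1 = v h2 + (2 * mu * T)%:E.
Proof.
have path0 h w : bounds h -> 0 <= \int[m0]_t integrand h t w.
  by move=> bh; apply: integral_ge0 => t _; exact: integrand_ge0.
have muT : (2 * mu * T)%:E = \int[P]_w \int[m0]_t ((2 * mu)%:E * (\1_D t)%:E).
  rewrite (eq_integral (cst (2 * mu * T)%:E)) => [|w _].
    by rewrite integral_cst//= probability_setT mule1.
  rewrite ge0_integralZl//.
  - by rewrite integral_indicT// lebesgue_after_window.
  - by apply/measurable_EFinP; exact: measurable_indic.
  - by rewrite lee_fin mulr_ge0// ltW.
have mu0 : (0 <= 2 * mu)%R by rewrite mulr_ge0// ltW.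
rewrite muT /v -(ge0_integralDT (mpath _ pind b0) (fun w => path0 _ w b0)
  (mpath _ ph1 b1) (fun w => path0 _ w b1)).
rewrite -(ge0_integralDT (mpath _ ph2 b2) (fun w => path0 _ w b2)); last 2 first.
- exact: measurable_cst.
- by move=> w; apply: integral_ge0 => t _; rewrite mule_ge0// lee_fin.
apply: eq_integral => w _.
have mD2 : measurable_fun setT (fun t : time => (2 * mu)%:E * (\1_D t)%:E : \bar R).
  by apply: emeasurable_funM => //; apply/measurable_EFinP; exact: measurable_indic.
rewrite -(ge0_integralDT (mintegrand _ w pind) (fun t => integrand_ge0 _ t w b0)
  (mintegrand _ w ph1) (fun t => integrand_ge0 _ t w b1)).
rewrite -(ge0_integralDT (mintegrand _ w ph2) (fun t => integrand_ge0 _ t w b2) mD2); last first.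
  by move=> t; rewrite mule_ge0// lee_fin.
apply: eq_integral => t _; rewrite /integrand -!EFinM -!EFinD; congr EFin.
have l_neq0 : (lambda t w != 0)%R by rewrite gt_eqF.
rewrite /h0 /h1 /h2 indicE; case: (t \in D); rewrite ?mul0r ?mulr0 ?addr0// !mul1r mulr1.
by field.
Qed.

Let X_split w : X h0 w = (X h1 w + X h2 w)%R.
Proof.
have h12 t : (h0 t w)%:E = (h1 t w)%:E + (h2 t w)%:E.
  by rewrite -EFinD /h0 /h1 /h2 -mulrDr addrCA subrr addr0 mulr1.
have uD : u h0 w = (u h1 w + u h2 w)%R.
  apply: EFin_inj; rewrite EFinD !uE//.
  rewrite -(ge0_integralDT (mh _ w ph1) (fun t => bounds_ge0 _ b1 (t, w))
    (mh _ w ph2) (fun t => bounds_ge0 _ b2 (t, w))).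
  by apply: eq_integral => t _; exact: h12.
have bD : b h0 w = (b h1 w + b h2 w)%R.
  have hl_ge0 h t : bounds h -> 0 <= (h t w)%:E * (lambda t w)%:E.
    by move=> bh; rewrite mule_ge0 ?(bounds_ge0 _ bh (t, w))// lee_fin ltW.
  apply: EFin_inj; rewrite EFinD !bE//.
  rewrite -(ge0_integralDT (emeasurable_funM (mh _ w ph1) (ml w)) (fun t => hl_ge0 _ t b1)
    (emeasurable_funM (mh _ w ph2) (ml w)) (fun t => hl_ge0 _ t b2)).
  apply: eq_integral => t _; rewrite h12 ge0_muleDl//.
  - exact: (bounds_ge0 _ b1 (t, w)).
  - exact: (bounds_ge0 _ b2 (t, w)).
by rewrite /X /= uD bD opprD addrACA.
Qed.

(** Here h0 is deterministic with integral T: this is the stationary bound. *)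
Let v0_le : v h0 <= (mu * T / (1 - rho))%:E.
Proof.
have -> : v h0 = \int[P]_w \int[m0]_t (predE h0 (t, w) * (lambda t w)%:E).
  apply: eq_integral => w _; apply: eq_integral => t _.
  by rewrite /h0/= muleA -EFinM indicE -natrM mulnb andbb.
rewrite -(expectation_intensity pointN intensityN _ pind (bounds_ge0 _ b0)).
apply: (expected_integral_le T T (ltW T_gt0) (fun t => (\1_D t)%:E)).
- by apply/measurable_EFinP; exact: measurable_indic.
- by move=> t; rewrite lee_fin.
- by move=> t; exact: (bounds_T _ b0 t point).
- have -> : \int[lebesgue_measure]_t (\1_D t)%:E = lebesgue_measure D by exact: integral_indicT.
  by rewrite /D lebesgue_measure_itv/= lte_fin T_gt0 sube0.
Qed.

(** The compensator of X h1 is not random: h1 lambda = mu on the window. *)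
Let b1E w : b h1 w = (mu * T)%R.
Proof.
apply: EFin_inj; rewrite bE// (eq_integral (fun t => mu%:E * (\1_D t)%:E)) => [|t _].
  rewrite ge0_integralZl//.
  - by rewrite integral_indicT// lebesgue_after_window.
  - by apply/measurable_EFinP; exact: measurable_indic.
  - by rewrite lee_fin ltW.
by rewrite -!EFinM /h1 -mulrA divfK ?gt_eqF// mulrC.
Qed.

Let exc := @excitation _ _ _ N g s0.

Let exc0 t w : (0 <= exc t w)%R. Proof. exact: (excitation_ge0 shape_g pointN). Qed.

Let mexc w : measurable_fun setT (fun t : time => (exc t w)%:E).
Proof. by apply/measurable_EFinP; exact: measurable_excitation. Qed.

Let exc_window w : \int[lebesgue_measure]_(t in `[0%R, T]) (exc t w)%:E = (b h2 w / rho)%:E.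
Proof.
rewrite integral_window//; last by move=> t; rewrite lee_fin.
have mDe : measurable_fun setT (fun t : time => (\1_D t)%:E * (exc t w)%:E).
  by apply: emeasurable_funM => //; apply/measurable_EFinP; exact: measurable_indic.
have e0 t : 0 <= (\1_D t)%:E * (exc t w)%:E by rewrite mule_ge0// lee_fin.
have bE2 : (b h2 w)%:E = rho%:E * \int[m0]_t ((\1_D t)%:E * (exc t w)%:E).
  rewrite bE// -ge0_integralZl//; last by rewrite lee_fin ltW.
  apply: eq_integral => t _; rewrite -!EFinM; congr EFin.
  have l_neq0 : (lambda t w != 0)%R by rewrite gt_eqF.
  have le : (lambda t w - mu = rho * exc t w)%R by rewrite /hawkes_lambda addrC addKr.
  by rewrite /h2 -mulrA mulrBl mul1r divfK// le mulrCA.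
rewrite mulrC EFinM bE2 muleA -EFinM mulVf ?gt_eqF// mul1e//.
Qed.

Let integrable_exc w :
  lebesgue_measure.-integrable `[0%R, T] (EFin \o (fun t => exc t w)).
Proof.
apply/integrableP; split; first exact: (measurable_funTS (mexc w)).
rewrite (eq_integral (fun t : time => (exc t w)%:E)) ?exc_window ?ltry// => t _.
by rewrite /= ger0_norm.
Qed.

Let compensator_window (m r : R) w :
  (\int[lebesgue_measure]_(t in `[0%R, T]) (m + r * exc t w) = m * T + r * (b h2 w / rho))%R.
Proof.
have mI : measurable (`[0%R, T] : set time) by exact: measurable_itv.
have cI : lebesgue_measure.-integrable `[0%R, T] (EFin \o (cst m : time -> R)).
  apply/integrableP; split; first exact: (@measurable_cst _ _ time _ _ m%:E).
  rewrite (eq_integral (cst `|m|%:E))// integral_cst//= lebesgue_measure_itv/= lte_fin.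
  by rewrite T_gt0 sube0 -EFinM ltry.
rewrite RintegralD//; last first.
  rewrite (_ : _ \o _ = fun t => r%:E * (EFin \o (fun t => exc t w)) t).
    exact: integrableZl.
  by apply/funext => t /=; rewrite EFinM.
rewrite RintegralZl// Rintegral_cst//= lebesgue_measure_itv/= lte_fin T_gt0 sube0/=.
by rewrite /Rintegral exc_window.
Qed.

(** The points of the window enter the log-likelihood for all parameters and the
    two integrals against N through one and the same list. *)
Let window_points w : exists2 s : seq R,
  (forall x y : R, loglik N g s0 T x y w =
    (\sum_(t <- s) ln (expR x + (1 - expR y) * exc t w)) -
    (expR x * T + (1 - expR y) * (b h2 w / rho)))%R &
  u h1 w = (\sum_(t <- s) mu / lambda t w)%R /\
  u h2 w = (\sum_(t <- s) (1 - mu / lambda t w))%R.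
Proof.
have [Y [_ finY NE]] := pointN w.
have DT : D `<=` `]-oo, T] by move=> t; rewrite /D/= !in_itv/= => /andP[].
have [s _ sE] := Rintegral_points finY NE _ _ mD DT.
have mexcR : measurable_fun setT (fun t : time => exc t w) by exact: measurable_excitation.
exists s.
  move=> x y; rewrite /loglik compensator_window -sE//.
  apply: measurable_funTS; apply: (measurableT_comp (@measurable_ln R)).
  by apply: measurable_funD => //; exact: measurable_funM.
have usum (r : time -> R) : measurable_fun setT r ->
    fine (\int[N w]_t (\1_D t * r t)%:E) = (\sum_(t <- s) r t)%R.
  move=> mr; rewrite -sE; last exact: measurable_funTS.
  rewrite /Rintegral [in RHS]integral_mkcond; congr fine; apply: eq_integral => t _.
  by rewrite patchE indicE; case: ifP => _; rewrite ?mul1r ?mul0r.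
have mfrac : measurable_fun setT (fun t : time => (mu / lambda t w)%R).
  exact: (measurableT_comp pfrac (measurable_pair_time N w)).
by split; apply: usum => //; exact: measurable_funB.
Qed.

Let expR_ln_mu : expR (ln mu) = mu. Proof. by rewrite lnK// posrE. Qed.

Let expR_ln_rho : expR (ln (1 - rho)) = (1 - rho)%R.
Proof. by rewrite lnK// posrE subr_gt0. Qed.

Let is_derive_theta w :
  is_derive (ln mu) (1 : R)%R (fun x : R => loglik N g s0 T x (ln (1 - rho)) w) (X h1 w).
Proof.
have [s lE [u1E _]] := window_points w.
rewrite (_ : (fun x => _) = (fun x => (\sum_(t <- s) ln (rho * exc t w + 1 * expR x)) -
    (rho * (b h2 w / rho) + T * expR x))%R); last first.
  apply/funext => x; rewrite lE expR_ln_rho subKr [(expR x * T)%R]mulrC addrC.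
  rewrite [(T * _ + _)%R]addrC addrC; congr (_ - _)%R.
  by apply: eq_bigr => t _; rewrite mul1r addrC.
have pos t : (0 < rho * exc t w + 1 * expR (ln mu))%R.
  by rewrite mul1r expR_ln_mu addrC; exact: lambda_gt0.
have := is_deriveB (is_derive_bigsum s _ _ _
  (fun t => is_derive_ln_affine_expR (rho * exc t w) 1 (ln mu) (pos t)))
  (is_derive_affine_expR (rho * (b h2 w / rho)) T (ln mu)).
move=> /is_derive_eq; apply; rewrite /X/= u1E b1E expR_ln_mu [(T * mu)%R]mulrC.
by congr (_ - _)%R; apply: eq_bigr => t _; rewrite !mul1r addrC.
Qed.

Let is_derive_eta w :
  is_derive (ln (1 - rho)) (1 : R)%R (fun y : R => loglik N g s0 T (ln mu) y w)
    (- ((1 - rho) / rho) * X h2 w)%R.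
Proof.
have [s lE [_ u2E]] := window_points w.
pose k := (b h2 w / rho)%R.
rewrite (_ : (fun y => _) = (fun y =>
    (\sum_(t <- s) ln ((mu + exc t w) + (- exc t w) * expR y)) -
    ((mu * T + k) + (- k) * expR y))%R); last first.
  apply/funext => y; rewrite lE expR_ln_mu -/k; congr (_ - _)%R; last by ring.
  by apply: eq_bigr => t _; congr (ln _); ring.
have lE' t : (mu + exc t w + - exc t w * expR (ln (1 - rho)) = lambda t w)%R.
  by rewrite expR_ln_rho /hawkes_lambda -/(excitation t w) -/exc; ring.
have pos t : (0 < mu + exc t w + - exc t w * expR (ln (1 - rho)))%R by rewrite lE'.
have := is_deriveB (is_derive_bigsum s _ _ _
  (fun t => is_derive_ln_affine_expR (mu + exc t w) (- exc t w) (ln (1 - rho)) (pos t)))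
  (is_derive_affine_expR (mu * T + k) (- k) (ln (1 - rho))).
move=> /is_derive_eq; apply; rewrite expR_ln_rho.
have -> : (- ((1 - rho) / rho) * X h2 w = (\sum_(t <- s)
    (- ((1 - rho) / rho) * (1 - mu / lambda t w))) - (- ((1 - rho) / rho) * b h2 w))%R.
  by rewrite -mulr_sumr -u2E -mulrBr.
have rho_neq0 : (rho != 0)%R by rewrite gt_eqF.
congr (_ - _)%R; last by rewrite /k; field.
apply: eq_bigr => t _; have := lE' t; rewrite expR_ln_rho => ->.
have l_neq0 : (lambda t w != 0)%R by rewrite gt_eqF.
have -> : exc t w = ((lambda t w - mu) / rho)%R.
  by rewrite /hawkes_lambda addrC addKr mulrC mulKf.
by field; rewrite l_neq0.
Qed.

Let theta_score w : score N g s0 T (ln mu) (ln (1 - rho)) 0%R w = X h1 w.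
Proof. by rewrite /score/= derive1E; have [_ ->] := is_derive_theta w. Qed.

Let eta_score w : score N g s0 T (ln mu) (ln (1 - rho)) 1%R w = (- ((1 - rho) / rho) * X h2 w)%R.
Proof. by rewrite /score/= derive1E; have [_ ->] := is_derive_eta w. Qed.

Let Rintegral_window (r : time -> R) : measurable_fun setT r -> (forall t, 0 <= r t)%R ->
  (\int[lebesgue_measure]_(t in `[0%R, T]) r t)%R = fine (\int[m0]_t ((\1_D t)%:E * (r t)%:E)).
Proof.
by move=> mr r0; rewrite /Rintegral integral_window//; exact/measurable_EFinP.
Qed.

(** The integrand of v before taking expectations; for h1 it is mu^2 / lambda, a
    multiple of 1 / V, and for h0 it is lambda, a multiple of V. *)
Let information_path h w : \bar R := \int[m0]_t integrand h t w.

Let path0E w : information_path h0 w = (b h0 w)%:E.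
Proof.
rewrite bE//; apply: eq_integral => t _.
by rewrite /integrand muleA -EFinM /h0 indicE -natrM mulnb andbb.
Qed.

Let path1_le w : information_path h1 w <= (mu * T)%:E.
Proof.
rewrite -(b1E w) bE//; apply: ge0_le_integral => //.
- by move=> t _; exact: integrand_ge0.
- exact: mintegrand.
- by apply: emeasurable_funM; [exact: mh|exact: ml].
- move=> t _; rewrite /integrand -!EFinM lee_fin ler_piMl//.
    by rewrite mulr_ge0 ?(ltW (lambda_gt0 t w))//; case/andP: (b1 t w).
  by case/andP: (b1 t w) => _ /le_trans; apply; case/andP: (ind01 t).
Qed.

Let path1_ge0 w : 0 <= information_path h1 w.
Proof. by apply: integral_ge0 => t _; exact: integrand_ge0. Qed.

Let path1_fin w : information_path h1 w \is a fin_num.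
Proof. by rewrite ge0_fin_numE//; exact: le_lt_trans (path1_le w) (ltry _). Qed.

Let a_gt0 : (0 < 1 - rho)%R. Proof. by rewrite subr_gt0. Qed.

Let Rintegral_path h k (r : time -> R) w : predictable N (predE h) -> bounds h ->
  information_path h w \is a fin_num -> (0 <= k)%R -> measurable_fun setT r ->
  (forall t, 0 <= r t)%R ->
  (forall t, (\1_D t)%:E * (r t)%:E = k%:E * integrand h t w) ->
  (\int[lebesgue_measure]_(t in `[0%R, T]) r t)%R = (k * fine (information_path h w))%R.
Proof.
move=> ph bh fin k0 mr r0 rE; rewrite Rintegral_window//.
rewrite (eq_integral (fun t : time => k%:E * integrand h t w)) => [|t _]; last exact: rE.
rewrite ge0_integralZl//; first by rewrite fineM.
- exact: mintegrand.
- by move=> t _; exact: integrand_ge0.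
Qed.

Let int_VE w : int_V N g s0 T mu rho w = ((1 - rho) / mu * b h0 w)%R.
Proof.
have relE t : rel_intensity N g s0 mu rho t w = ((1 - rho) / mu * lambda t w)%R.
  by rewrite /rel_intensity invf_div mulrC.
have k0 : (0 <= (1 - rho) / mu)%R by rewrite divr_ge0// ltW.
rewrite -[b h0 w]/(fine (b h0 w)%:E) -path0E.
apply: Rintegral_path => //; rewrite ?path0E//.
- rewrite (_ : (fun t => _) = fun t => ((1 - rho) / mu * lambda t w)%R); last exact/funext.
  by apply: measurable_funM => //; exact: measurable_hawkes_lambda.
- by move=> t; rewrite relE mulr_ge0// ltW.
- move=> t; rewrite relE /integrand -!EFinM /h0 indicE; congr EFin.
  by case: (t \in D); rewrite ?mul1r// !mul0r mulr0.
Qed.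

Let int_invVE w :
  int_invV N g s0 T mu rho w = ((mu * (1 - rho))^-1 * fine (information_path h1 w))%R.
Proof.
have relE t : ((rel_intensity N g s0 mu rho t w)^-1 = (1 - rho)^-1 * (mu / lambda t w))%R.
  by rewrite /rel_intensity invf_div mulrAC mulrC.
have k0 : (0 <= (mu * (1 - rho))^-1)%R by rewrite invr_ge0 mulr_ge0// ltW.
apply: Rintegral_path => //.
- rewrite (_ : (fun t => _) = fun t => ((1 - rho)^-1 * (mu / lambda t w))%R); last exact/funext.
  apply: measurable_funM => //.
  exact: (measurableT_comp pfrac (measurable_pair_time N w)).
- by move=> t; rewrite relE mulr_ge0 ?invr_ge0 ?(ltW a_gt0)//; case/andP: (frac01 t w).
- move=> t; rewrite relE /integrand -!EFinM /h1 indicE; congr EFin.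
  have l_neq0 : (lambda t w != 0)%R by rewrite gt_eqF.
  have a_neq0 : (1 - rho != 0)%R by rewrite gt_eqF.
  have mu_neq0 : (mu != 0)%R by rewrite gt_eqF.
  case: (t \in D); rewrite ?mul1r ?mul0r ?mulr0//.
  by field; rewrite l_neq0 a_neq0.
Qed.

Let path1_Lfun : (fun w => fine (information_path h1 w)) \in Lfun P 1.
Proof.
apply: Lfun_subset12; first exact: fin_num_measure.
have mp : measurable_fun setT (fun w => fine (information_path h1 w)).
  by apply: (measurableT_comp _ (mpath _ ph1 b1)).
apply: Lfun2P => //; apply: (@le_lt_trans _ _ (\int[P]_w (cst ((mu * T) ^+ 2)%:E w))).
  apply: ge0_le_integral => //.
  - by move=> w _; rewrite lee_fin sqr_ge0.
  - by apply/measurable_EFinP; exact: measurable_funX.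
  - move=> w _; rewrite lee_fin.
    have p0 : (0 <= fine (information_path h1 w))%R by exact: fine_ge0.
    have ple : (fine (information_path h1 w) <= mu * T)%R by rewrite -lee_fin fineK.
    by rewrite ler_pXn2r ?nnegrE// (le_trans p0).
by rewrite integral_cst//= probability_setT mule1 ltry.
Qed.

Let int_invV_Lfun : int_invV N g s0 T mu rho \in Lfun P 1.
Proof.
rewrite (_ : int_invV _ _ _ _ _ _ =
    (mu * (1 - rho))^-1%R \o* (fun w => fine (information_path h1 w))).
  exact: Lfun_scale.
by apply/funext => w; rewrite int_invVE /=; exact: mulrC.
Qed.

Let b0_Lfun1 : b h0 \in Lfun P 1.
Proof.
have [Lb _ _] := moments _ pind b0.
by apply: Lfun_subset12 Lb; exact: fin_num_measure.
Qed.

Let int_V_Lfun : int_V N g s0 T mu rho \in Lfun P 1.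
Proof.
rewrite (_ : int_V _ _ _ _ _ _ = ((1 - rho) / mu)%R \o* b h0).
  exact: Lfun_scale.
by apply/funext => w; rewrite int_VE /=; exact: mulrC.
Qed.

Let A_coefE : A_coef P N g s0 T mu rho = (T^-1 * ((mu * (1 - rho))^-1 * fine (v h1)))%R.
Proof.
rewrite /A_coef; congr (_ * _)%R.
rewrite (_ : int_invV _ _ _ _ _ _ =
    (mu * (1 - rho))^-1%R \o* (fun w => fine (information_path h1 w))); last first.
  by apply/funext => w; rewrite int_invVE /=; exact: mulrC.
rewrite (expectationZl _ path1_Lfun) fineM; [|by []|exact: expectation_fin_num].
congr (_ * fine _)%R.
by rewrite unlock; apply: eq_integral => w _; rewrite fineK.
Qed.

Let D_coefE : D_coef P N g s0 T mu rho = (T^-1 * ((1 - rho) / mu * fine (v h0)))%R.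
Proof.
rewrite /D_coef; congr (_ * _)%R.
rewrite (_ : int_V _ _ _ _ _ _ = ((1 - rho) / mu)%R \o* b h0); last first.
  by apply/funext => w; rewrite int_VE /=; exact: mulrC.
rewrite (expectationZl _ b0_Lfun1) fineM; [|by []|exact: expectation_fin_num].
congr (_ * fine _)%R.
by rewrite unlock; apply: eq_integral => w _; rewrite -path0E.
Qed.

(** Polarization: X h0 = X h1 + X h2, and v h0 + v h1 = v h2 + 2 mu T. *)
Let cov12 : covariance P (X h1) (X h2) = (mu * T - fine (v h1))%:E.
Proof.
have [_ L0 V0] := moments _ pind b0.
have [_ L1 V1] := moments _ ph1 b1.
have [_ L2 V2] := moments _ ph2 b2.
have Pfin : P setT \is a fin_num by exact: fin_num_measure.
have cfin : covariance P (X h1) (X h2) \is a fin_num.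
  apply: covariance_fin_num; [exact: Lfun_subset12|exact: Lfun_subset12|].
  exact: Lfun2_mul_Lfun1.
have := varianceD L1 L2.
rewrite (_ : (X h1 \+ X h2)%R = X h0); last by apply/funext => w; rewrite X_split.
rewrite V0 V1 V2 => sum; have rel := information_relation.
move: (v_fin _ pind b0) (v_fin _ ph1 b1) (v_fin _ ph2 b2) cfin sum rel.
move: (v h0) (v h1) (v h2) (covariance P (X h1) (X h2)).
move=> [x0| |] [x1| |] [x2| |] [c| |] // _ _ _ _.
rewrite -EFinM -!EFinD => s1 s2.
have r1 := EFin_inj s1; have r2 := EFin_inj s2.
by congr EFin => /=; move: r1 r2; lra.
Qed.

(** By Cauchy-Schwarz v h1 = 0 would make the covariance vanish, whereas it would
    be mu T. *)
Let v1_gt0 : (0 < fine (v h1))%R.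
Proof.
have [_ L1 V1] := moments _ ph1 b1.
have [_ L2 V2] := moments _ ph2 b2.
have v1_ge0 : 0 <= v h1 by rewrite -V1 variance_ge0.
rewrite lt_neqAle fine_ge0// andbT eq_sym; apply/eqP => v10.
have := covariance_le L1 L2; rewrite cov12 V1 -(fineK (v_fin _ ph1 b1)) v10.
rewrite /sqrte sqrtr0 mul0e subr0 lee_fin leNgt mulr_gt0//.
Qed.

Lemma D_coef_le1 : (D_coef P N g s0 T mu rho <= 1)%R.
Proof.
have := v0_le; rewrite -(fineK (v_fin _ pind b0)) lee_fin => v0le.
rewrite D_coefE mulrA mulrC -ler_pdivlMr ?mulr_gt0 ?invr_gt0 ?divr_gt0//.
apply: le_trans v0le _; rewrite le_eqVlt; apply/orP; left; apply/eqP.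
have a_neq0 : (1 - rho != 0)%R by rewrite gt_eqF.
have mu_neq0 : (mu != 0)%R by rewrite gt_eqF.
have T_neq0 : (T != 0)%R by rewrite gt_eqF.
by field; rewrite mu_neq0 T_neq0.
Qed.

Let scoreE0 : score N g s0 T (ln mu) (ln (1 - rho)) 0%R = X h1.
Proof. by apply/funext => w; exact: theta_score. Qed.

Let scoreE1 : score N g s0 T (ln mu) (ln (1 - rho)) 1%R = (- ((1 - rho) / rho))%R \o* X h2.
Proof. by apply/funext => w; rewrite eta_score /=; exact: mulrC. Qed.

Let score_Lfun i : score N g s0 T (ln mu) (ln (1 - rho)) i \in Lfun P 2%:E.
Proof.
have [_ L1 _] := moments _ ph1 b1.
have [_ L2 _] := moments _ ph2 b2.
have [->|->] : i = 0%R \/ i = 1%R.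
  by case: i => [[|[|//]] ?]; [left|right]; exact: val_inj.
- by rewrite scoreE0.
- by rewrite scoreE1; apply: Lfun_scale => //; rewrite ler1n.
Qed.

(** * The Fisher information matrix *)

Local Notation J := (fisher_info P N g s0 T (ln mu) (ln (1 - rho))).

Let J_sym i j : J i j = J j i.
Proof. by rewrite /fisher_info [LHS]mxE [RHS]mxE covarianceC. Qed.

Let J00 : J 0%R 0%R = fine (v h1).
Proof. by have [_ _ <-] := moments _ ph1 b1; rewrite mxE scoreE0. Qed.

Let J01 : J 0%R 1%R = (- ((1 - rho) / rho) * (mu * T - fine (v h1)))%R.
Proof.
have [_ L1 _] := moments _ ph1 b1; have [_ L2 _] := moments _ ph2 b2.
have Pfin : P setT \is a fin_num by exact: fin_num_measure.
rewrite mxE scoreE0 scoreE1 covarianceZr ?cov12//.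
- exact: Lfun_subset12.
- exact: Lfun_subset12.
- exact: Lfun2_mul_Lfun1.
Qed.

Let J11 : J 1%R 1%R =
  (((1 - rho) / rho) ^+ 2 * (fine (v h0) + fine (v h1) - 2 * mu * T))%R.
Proof.
have [_ L2 V2] := moments _ ph2 b2.
rewrite mxE scoreE1 (_ : covariance P _ _ = 'V_P[(- ((1 - rho) / rho))%R \o* X h2])//.
rewrite varianceZ// V2 sqrrN.
have := information_relation.
move: (v_fin _ pind b0) (v_fin _ ph1 b1) (v_fin _ ph2 b2).
move: (v h0) (v h1) (v h2) => [x0| |] [x1| |] [x2| |] // _ _ _ s1.
by have r1 := EFin_inj s1; rewrite -EFinM /= r1 addrK.
Qed.

Lemma hawkes_fisher_info :
  let a := (1 - rho)%R in
  let I := (T * mu * (1 - rho))%R in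
  let A := A_coef P N g s0 T mu rho in
  let D := D_coef P N g s0 T mu rho in
  [/\ J 0%R 0%R = (I * A)%R, J 0%R 1%R = (I * - ((1 - a * A) / rho))%R,
      J 1%R 0%R = (I * - ((1 - a * A) / rho))%R &
      J 1%R 1%R = (I * ((D - 2 * a + a ^+ 2 * A) / rho ^+ 2))%R].
Proof.
have a_neq0 : (1 - rho != 0)%R by rewrite gt_eqF.
have mu_neq0 : (mu != 0)%R by rewrite gt_eqF.
have T_neq0 : (T != 0)%R by rewrite gt_eqF.
have rho_neq0 : (rho != 0)%R by rewrite gt_eqF.
(* x0 and x1 stand for v h0 and v h1, which determine all the entries. *)
have entries (x0 x1 A D' I : R) : I = (T * mu * (1 - rho))%R ->
    A = (T^-1 * ((mu * (1 - rho))^-1 * x1))%R -> D' = (T^-1 * ((1 - rho) / mu * x0))%R ->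
  [/\ x1 = (I * A)%R,
      (- ((1 - rho) / rho) * (mu * T - x1) = I * - ((1 - (1 - rho) * A) / rho))%R,
      (- ((1 - rho) / rho) * (mu * T - x1) = I * - ((1 - (1 - rho) * A) / rho))%R &
      (((1 - rho) / rho) ^+ 2 * (x0 + x1 - 2 * mu * T) =
        I * ((D' - 2 * (1 - rho) + (1 - rho) ^+ 2 * A) / rho ^+ 2))%R].
  by move=> -> -> ->; split; field; rewrite ?rho_neq0 ?a_neq0 ?T_neq0 ?mu_neq0.
by rewrite (J_sym 1%R) J00 J01 J11; apply: entries; [|exact: A_coefE|exact: D_coefE].
Qed.

Lemma hawkes_fisher_well_defined : fisher_well_defined P N g s0 T mu rho.
Proof.
split; [| |exact: score_Lfun|exact: int_invV_Lfun|exact: int_V_Lfun].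
- by move=> w; have [der _] := is_derive_theta w.
- by move=> w; have [der _] := is_derive_eta w.
Qed.

Lemma A_coef_gt0 : (0 < A_coef P N g s0 T mu rho)%R.
Proof. by rewrite A_coefE mulr_gt0 ?invr_gt0// mulr_gt0// invr_gt0 mulr_gt0. Qed.

End Window.
End HawkesMoments.

(** * Efficient informations *)

Theorem theorem4p1 (R : realType) (d : measure_display)
    (Omega : measurableType d) (P : probability Omega R)
    (N : R.-ker Omega ~> (measurableTypeR R))
    (g : R -> R) (s0 T mu rho : R)
    (hs0 : s0 <= 0) (hT : 0 < T) (hmu : 0 < mu) (hrho : 0 < rho < 1)
    (hg : kernel_shape g) (hN : linear_hawkes P N g s0 mu rho) :
  let a := 1 - rho in
  let I := T * mu * (1 - rho) in
  let A := A_coef P N g s0 T mu rho in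
  let D := D_coef P N g s0 T mu rho in
  let J := fisher_info P N g s0 T (ln mu) (ln (1 - rho)) in
  [/\ fisher_well_defined P N g s0 T mu rho,
      J = I *: mx2 A (- ((1 - a * A) / rho))
                   (- ((1 - a * A) / rho))
                   ((D - 2 * a + a ^+ 2 * A) / rho ^+ 2),
      J 1 1 != 0 ->
        efficient_info0 J = I * ((A * D - 1) / (D - 2 * a + a ^+ 2 * A)) &
      [/\ J 0 0 != 0,
          efficient_info1 J = I / rho ^+ 2 * (D - A^-1) &
          efficient_info1 J <= I / rho ^+ 2]].
Proof.
have [hrho0 hrho1] := andP hrho.
have A_gt0 := A_coef_gt0 hmu hrho0 hrho1 hg hN T hT hs0.
have D_le1 := D_coef_le1 hmu hrho0 hrho1 hg hN T hT hs0.
have [J00 J01 J10 J11] := hawkes_fisher_info hmu hrho0 hrho1 hg hN T hT hs0.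
have wd := hawkes_fisher_well_defined hmu hrho0 hrho1 hg hN T hT hs0.
move: A_gt0 D_le1 J00 J01 J10 J11 => /=.
set a := 1 - rho; set I := T * mu * a; set A := A_coef _ _ _ _ _ _ _.
set D := D_coef _ _ _ _ _ _ _; set J := fisher_info _ _ _ _ _ _ _.
move=> A_gt0 D_le1 J00 J01 J10 J11.
have rho_neq0 : rho != 0 by rewrite gt_eqF.
have A_neq0 : A != 0 by rewrite gt_eqF.
have I_gt0 : 0 < I by rewrite !mulr_gt0// subr_gt0.
have I_neq0 : I != 0 by rewrite gt_eqF.
have rhoE : rho = 1 - a by rewrite subKr.
have e1E : efficient_info1 J = I / rho ^+ 2 * (D - A^-1).
  rewrite /efficient_info1 J00 J01 J11; field; by rewrite A_neq0 rho_neq0 I_neq0.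
split.
- by [].
- apply/matrixP => -[[|[|//]] i2] [[|[|//]] j2]; rewrite [RHS]mxE [X in _ * X]mxE /=.
  + by rewrite -J00; congr (J _ _); exact: val_inj.
  + by rewrite -J01; congr (J _ _); exact: val_inj.
  + by rewrite -J10; congr (J _ _); exact: val_inj.
  + by rewrite -J11; congr (J _ _); exact: val_inj.
- rewrite /efficient_info0 J00 J01 J11 mulf_eq0 (negPf I_neq0)/=.
  rewrite mulf_eq0 negb_or => /andP[den_neq0 _].
  rewrite rhoE; field; rewrite den_neq0 I_neq0 -rhoE rho_neq0.
  by [].
- split; [by rewrite J00 mulf_neq0|exact: e1E|].
  rewrite e1E ler_piMr ?divr_ge0 ?sqr_ge0 ?(ltW I_gt0)//.
  have : 0 < A^-1 by rewrite invr_gt0.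
  lra.
Qed.
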